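(* Let $B\in\mathbb R^{m\times n}$ have singular values $\sigma_1\ge\dots\ge\sigma_k>\sigma_{k+1}\ge\dots\ge 0$, and let $\bar X$ be the unique best rank-$k$ approximation of $B$ (in Frobenius norm). Then: (a) The sequence $X_{\ell+1}=\mathbf S(X_\ell)=\mathbf S_2(\mathbf S_1(X_\ell))$, that is, $$X_{\ell+1/2}=BX_\ell^+X_\ell,\qquad X_{\ell+1}=X_{\ell+1/2}X_{\ell+1/2}^+B,$$ with $X_0\in\mathcal M_k$, is (in exact arithmetic) identical to the sequence $X_\ell=U_\ell S_\ell V_\ell^T$, $\ell\ge1$, generated by the simultaneous orthogonal iteration started with a matrix $V_0\in\mathbb R^{n\times k}$ with orthonormal columns spanning the row space of $X_0$, as long as all constructed matrices $X_\ell$, $X_{\ell+1/2}$ retain rank $k$. (b) With $\bar{\mathbf P}=\mathbf P(\bar X)$, $$\rho(\mathbf S'(\bar X)\bar{\mathbf P})=\left(\frac{\sigma_{k+1}}{\sigma_k}\right)^2,$$ where $\rho$ denotes the spectral radius. (c) For starting guesses $X_0\in\mathcal M_k$ close enough to $\bar X$, the sequence $(X_\ell)$ converges $R$-linearly to $\bar X$ with $$\limsup_{\ell\to\infty}\|X_\ell-\bar X\|^{1/\ell}\le\left(\frac{\sigma_{k+1}}{\sigma_k}\right)^2$$ (in any norm), and, in the sense of the operator norm of projectors, $$\limsup_{\ell\to\infty}\|\mathbf P_i(X_\ell)-\mathbf P_i(\bar X)\|^{1/\ell}\le\left(\frac{\sigma_{k+1}}{\sigma_k}\right)^2,\qquad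 i=1,2.$$
   Context: Here $1\le k\le\min(m,n)$, with $\sigma_{k+1}:=0$ if $k=\min(m,n)$, and $\mathcal M_k=\{X\in\mathbb R^{m\times n}:\operatorname{rank}(X)=k\}$, a smooth embedded submanifold of $\mathbb R^{m\times n}$. $X^+$ is the Moore–Penrose inverse. $\mathbb R^{m\times n}$ carries the Frobenius inner product. Projections: for $X\in\mathcal M_k$, $\mathbf P_1(X)[Z]=ZX^+X$ and $\mathbf P_2(X)[Z]=XX^+Z$ for $Z\in\mathbb R^{m\times n}$; these are the orthogonal projections onto $T_1(X)=\{Y:\operatorname{row}(Y)\subseteq\operatorname{row}(X)\}$ and $T_2(X)=\{Y:\operatorname{col}(Y)\subseteq\operatorname{col}(X)\}$. $\mathbf P(X)=\mathbf P_1(X)+\mathbf P_2(X)-\mathbf P_1(X)\mathbf P_2(X)$ is the orthogonal projection onto $T(X)=T_1(X)+T_2(X)$, which is the tangent space to $\mathcal M_k$ at $X$. To have maps that are smooth on an open neighborhood of $\mathcal M_k$, the $\mathbf P_i$ are extended to the open set $\mathcal D$ of matrices whose $k$-th singular value is strictly larger than the $(k+1)$-th one by $\mathbf P_1(X)[Z]=ZV(X)V(X)^T$, $\mathbf P_2(X)[Z]=U(X)U(X)^TZ$, where the columns of $U(X)\in\mathbb R^{m\times k}$ and $V(X)\in\mathbb R^{n\times k}$ are orthonormal dominant $k$ left, respectively right, singular vectors of $X$; this coincides with the previous definition on $\mathcal M_k$. Iteration map: $\mathbf S_1(X)=\mathbf P_1(X)[B]$ and $\mathbf S_2(X)=\mathbf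 P_2(X)[B]$ (so on $\mathcal M_k$: $\mathbf S_1(X)=BX^+X$, $\mathbf S_2(X)=XX^+B$), and $\mathbf S=\mathbf S_2\circ\mathbf S_1$. This is alternating optimization for minimizing $\frac12\|X-B\|_F^2$ subject to $\operatorname{rank}(X)\le k$. Simultaneous orthogonal iteration: given $V_0\in\mathbb R^{n\times k}$ with $V_0^TV_0=I$, for $\ell=0,1,2,\dots$: compute a tall QR decomposition $QR=BV_\ell$ and set $U_{\ell+1}=Q$; compute a tall QR decomposition $QR=B^TU_{\ell+1}$ and set $V_{\ell+1}=Q$, $S_{\ell+1}=R^T$. *)

(* Defs.v *)
From HB Require Import structures.
From mathcomp Require Import all_boot all_order all_algebra.
From mathcomp Require Import complex.
From mathcomp Require Import all_classical all_reals all_analysis.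

Set Implicit Arguments.
Unset Strict Implicit.
Unset Printing Implicit Defensive.

Import Order.TTheory GRing.Theory Num.Theory.
Import numFieldNormedType.Exports.

Local Open Scope classical_set_scope.
Local Open Scope ring_scope.

Section SingularValues.
Context {R : realType} {m n : nat}.
Implicit Types (X Z B : 'M[R]_(m, n)) (s : nat -> R).

(* Singular values are numbered from 1, as s 1 >= s 2 >= ... >= 0, and
   s i = 0 for i > min(m, n); the value s 0 carries no information. *)
Definition sv_mx s : 'M[R]_(m, n) :=
  \matrix_(i, j) (if i == j :> nat then s i.+1 else 0).

Definition is_svd X (U : 'M[R]_m) s (V : 'M[R]_n) : Prop :=
  [/\ U^T *m U = 1%:M, V^T *m V = 1%:M,
      (forall i, 0 <= s i) /\
      (forall i j, (1 <= i)%N -> (i <= j)%N -> s j <= s i),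
      (forall i, (minn m n < i)%N -> s i = 0) &
      X = U *m sv_mx s *m V^T].

Definition singular_values X s : Prop := exists U V, is_svd X U s V.

(* Right multiplication by pid_mx k : 'M_(p, k) keeps the first k columns. *)
Definition dominant_left k X (Uk : 'M[R]_(m, k)) : Prop :=
  exists U s V, is_svd X U s V /\ Uk = U *m pid_mx k.

Definition dominant_right k X (Vk : 'M[R]_(n, k)) : Prop :=
  exists U s V, is_svd X U s V /\ Vk = V *m pid_mx k.

(* The columns of left_vectors and right_vectors are some orthonormal dominant
   singular vectors. The projectors below do not depend on this choice when
   the k-th singular value of X is larger than the (k+1)-th one. *)
Definition left_vectors k X : 'M[R]_(m, k) := xget 0 [set U | dominant_left X U].

Definition right_vectors k X : 'M[R]_(n, k) :=
  xget 0 [set V | dominant_right X V].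

Definition P1 k X Z := let V := right_vectors k X in Z *m V *m V^T.

Definition P2 k X Z := let U := left_vectors k X in U *m U^T *m Z.

Definition Ptan k X Z := P1 k X Z + P2 k X Z - P1 k X (P2 k X Z).

Definition S1 k B X := P1 k X B.

Definition S2 k B X := P2 k X B.

Definition Smap k B : 'M[R]_(m, n) -> 'M[R]_(m, n) := S2 k B \o S1 k B.

End SingularValues.

Section MoorePenrose.
Context {R : realType} {m n : nat}.

Definition penrose (X : 'M[R]_(m, n)) (Y : 'M[R]_(n, m)) : Prop :=
  [/\ X *m Y *m X = X, Y *m X *m Y = Y,
      (X *m Y)^T = X *m Y & (Y *m X)^T = Y *m X].

Definition mp_inv (X : 'M[R]_(m, n)) : 'M[R]_(n, m) := xget 0 [set Y | penrose X Y].

End MoorePenrose.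

Section Norms.
Context {R : realType} {m n : nat}.
Implicit Types (X Y B : 'M[R]_(m, n)).

Definition frobenius X : R := Num.sqrt (\tr (X^T *m X)).

Definition is_norm (N : 'M[R]_(m, n) -> R) : Prop :=
  [/\ forall X Y, N (X + Y) <= N X + N Y,
      forall a X, N (a *: X) = `|a| * N X &
      forall X, N X = 0 -> X = 0].

Definition op_norm (f : 'M[R]_(m, n) -> 'M[R]_(m, n)) : R :=
  sup [set frobenius (f Z) | Z in [set Z | frobenius Z <= 1]].

Definition best_rank_approx k B X : Prop :=
  (\rank X <= k)%N /\
  forall Y, (\rank Y <= k)%N -> frobenius (X - B) <= frobenius (Y - B).

Definition R_linear_cvg (N : 'M[R]_(m, n) -> R) (x : nat -> 'M[R]_(m, n)) X :=
  exists C q : R, [/\ 0 <= q, q < 1 & forall l, N (x l - X) <= C * q ^+ l].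

(* The term l = 0 has exponent 0^-1 = 0 and is irrelevant for the limsup. *)
Definition limsup_root (u : nat -> R) : \bar R :=
  limn_esup (fun l => (u l `^ l%:R^-1)%:E).

(* Largest modulus of a complex eigenvalue; lin_mx f is the matrix of f acting
   on vectorized matrices. *)
Definition spectral_radius (f : 'M[R]_(m, n) -> 'M[R]_(m, n)) : R :=
  sup [set ComplexField.Normc.normc z |
        z in [set z : R[i] | eigenvalue (map_mx (real_complex R) (lin_mx f)) z]].

End Norms.

Section OrthogonalIteration.
Context {R : realType} {m n k : nat}.

(* is_trig_mx means lower triangular, so T is upper triangular. *)
Definition tall_qr p (A Q : 'M[R]_(p, k)) (T : 'M[R]_k) : Prop :=
  [/\ Q^T *m Q = 1%:M, is_trig_mx T^T & A = Q *m T].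

(* QR decompositions are not unique: the relation holds for every run of the
   iteration. U 0 and S 0 are not used. *)
Definition orthogonal_iteration (B : 'M[R]_(m, n)) (U : nat -> 'M[R]_(m, k))
    (S : nat -> 'M[R]_k) (V : nat -> 'M[R]_(n, k)) : Prop :=
  (V 0%N)^T *m V 0%N = 1%:M /\
  forall l, (exists T, tall_qr (B *m V l) (U l.+1) T) /\
            tall_qr (B^T *m U l.+1) (V l.+1) (S l.+1)^T.

End OrthogonalIteration.

(* Main.v *)
Require Import Defs.
From HB Require Import structures.
From mathcomp Require Import all_boot all_order all_algebra.
From mathcomp Require Import complex.
From mathcomp Require Import all_classical all_reals all_analysis.
From mathcomp Require Import ring lra.

Set Implicit Arguments.
Unset Strict Implicit.
Unset Printing Implicit Defensive.

Import Order.TTheory GRing.Theory Num.Theory.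
Import numFieldNormedType.Exports.

Local Open Scope classical_set_scope.
Local Open Scope ring_scope.

(** Idea of the proof.

    On a matrix of rank k, S_1 returns B times the orthogonal projector onto its row
    space, and S_2 acts in the same way on column spaces. So the iteration is a
    subspace iteration: row spaces are mapped by B^T B. This is what simultaneous
    orthogonal iteration computes, up to the choice of an orthonormal basis, which
    gives (a) ([orthogonal_iterationE]). The formulas with
    Moore-Penrose inverses hold because an orthogonal projector is determined by its
    row space.

    The maps P_i are defined by arbitrarily chosen dominant singular vectors, so
    singular value decompositions must exist ([svd_exists]) and the projectors must be
    characterized independently of the choice. The Eckart-Young inequality
    ([eckart_young]) does this: it says that X (1 - P) is not larger than X - Y for any
    Y of rank at most k, where P projects onto dominant right singular vectors. For
    Y = X it identifies P when X has rank k, its equality case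
    ([eckart_young_unique]) gives the uniqueness of the best approximation Xb, and for
    Y = Xb it gives the perturbation bound behind (b).

    For (b), let G be the pseudoinverse of Xb and P_0 = G Xb. For every X,
    the projector P of X is P_0 + G E (1 - P_0) + (1 - P_0) E^T G^T up to an
    error quadratic in E = X - Xb ([projector_first_order]). Hence S is differentiable
    at Xb with derivative E |-> C E^T G^T + G^T G E C^T C, where C = B - Xb
    ([Smap_is_diff]); it vanishes on the orthogonal complement of the tangent space
    ([Smap_tangent]). In the singular bases of B, the second summand multiplies the
    entry (i, j) by (sigma_j / sigma_i)^2 for i <= k < j and kills the other ones, while
    the first one maps that block to the opposite one, on which the derivative
    vanishes. So the eigenvalues are 0 and these squared quotients, of which
    (sigma_(k+1) / sigma_k)^2 is the largest ([spectral_radius_Smap]).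

    For (c), a row space near that of Xb is the graph V_1^T + Z of a small matrix Z with
    Z V_1 = 0, where the columns of V_1 are the dominant right singular vectors of B
    ([near_graph]). In this coordinate the iteration is linear,
    Z |-> D^-2 Z B^T B with D the diagonal matrix of the dominant singular values, and
    contracts the Frobenius norm by (sigma_(k+1) / sigma_k)^2 ([full_step]). The
    distances of the projectors, and with them X_l - Xb, are bounded by a constant
    times the norm of Z ([graph_projector]), which gives all the rates
    ([local_convergence]). *)

(** * Squared Frobenius norm and orthogonal projectors *)

Section SquaredNorm.
Context {R : realFieldType}.

(** Working with the square keeps the algebra polynomial; the price is the factor
    2 in [sqFD], which replaces the triangle inequality. *)
Definition sqF {m n} (X : 'M[R]_(m, n)) : R := \tr (X^T *m X).

Lemma sqFE m n (X : 'M[R]_(m, n)) : sqF X = \sum_i \sum_j X i j ^+ 2.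
Proof.
rewrite exchange_big; apply: eq_bigr => j _; rewrite mxE.
by apply: eq_bigr => i _; rewrite mxE expr2.
Qed.

Lemma sqF_ge0 m n (X : 'M[R]_(m, n)) : 0 <= sqF X.
Proof. by rewrite sqFE; do 2![apply: sumr_ge0 => ? _]; exact: sqr_ge0. Qed.

Lemma sqr_entry_le_sqF m n (X : 'M[R]_(m, n)) i j : X i j ^+ 2 <= sqF X.
Proof.
rewrite sqFE (bigD1 i) //= (bigD1 j) //= -addrA lerDl.
by apply: addr_ge0; do ![apply: sumr_ge0 => ? _]; exact: sqr_ge0.
Qed.

Lemma sqF_eq0 m n (X : 'M[R]_(m, n)) : sqF X <= 0 -> X = 0.
Proof.
move=> X0; apply/matrixP => i j; rewrite mxE.
by apply/eqP; rewrite -sqrf_eq0 eq_le sqr_ge0 (le_trans (sqr_entry_le_sqF X i j)).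
Qed.

Lemma sqF0 m n : sqF (0 : 'M[R]_(m, n)) = 0.
Proof. by rewrite /sqF mulmx0 mxtrace0. Qed.

Lemma sqF_tr m n (X : 'M[R]_(m, n)) : sqF X^T = sqF X.
Proof. by rewrite /sqF trmxK mxtrace_mulC. Qed.

Lemma sqFZ m n a (X : 'M[R]_(m, n)) : sqF (a *: X) = a ^+ 2 * sqF X.
Proof. by rewrite /sqF [(_ *: X)^T]linearZ/= -scalemxAl -scalemxAr scalerA mxtraceZ
  expr2. Qed.

Lemma sqFN m n (X : 'M[R]_(m, n)) : sqF (- X) = sqF X.
Proof. by rewrite -scaleN1r sqFZ sqrrN expr1n mul1r. Qed.

Lemma sqFD m n (X Y : 'M[R]_(m, n)) : sqF (X + Y) <= 2 * sqF X + 2 * sqF Y.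
Proof.
rewrite !sqFE !mulr_sumr -big_split/=; apply: ler_sum => i _.
rewrite !mulr_sumr -big_split/=; apply: ler_sum => j _; rewrite mxE.
have := sqr_ge0 (X i j - Y i j); lra.
Qed.

(** Lagrange's identity: twice the defect is the sum over i, j of
    (a i * b j - a j * b i) ^ 2. *)
Lemma cauchy_schwarz_sum n (a b : 'I_n -> R) :
  (\sum_i a i * b i) ^+ 2 <= (\sum_i a i ^+ 2) * (\sum_i b i ^+ 2).
Proof.
suff : 0 <= 2 * ((\sum_i a i ^+ 2) * (\sum_i b i ^+ 2) - (\sum_i a i * b i) ^+ 2).
  by rewrite pmulr_rge0 ?ltr0n// subr_ge0.
have -> : 2 * ((\sum_i a i ^+ 2) * (\sum_i b i ^+ 2) - (\sum_i a i * b i) ^+ 2)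
   = \sum_i \sum_j (a i * b j - a j * b i) ^+ 2.
  rewrite mulrBr [2 * (_ * _)]mulrDl !mul1r {2}[_ * (\sum_i b i ^+ 2)]mulrC expr2.
  rewrite !big_distrlr/= mulr_sumr -big_split -sumrB/=; apply: eq_bigr => i _.
  rewrite mulr_sumr -big_split -sumrB/=; apply: eq_bigr => j _; ring.
by do 2![apply: sumr_ge0 => ? _]; exact: sqr_ge0.
Qed.

Lemma sqFM m n p (X : 'M[R]_(m, n)) (Y : 'M[R]_(n, p)) :
  sqF (X *m Y) <= sqF X * sqF Y.
Proof.
rewrite -[sqF Y]sqF_tr !sqFE big_distrlr/=.
apply: ler_sum => i _; apply: ler_sum => j _; rewrite mxE.
apply: le_trans (cauchy_schwarz_sum _ _) _.
rewrite [X in _ <= _ * X](eq_bigr (fun l => Y l j ^+ 2)) // => l _.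
by rewrite mxE.
Qed.

Lemma sqFM_le m n p (X : 'M[R]_(m, n)) (Y : 'M[R]_(n, p)) a b :
  sqF X <= a -> sqF Y <= b -> sqF (X *m Y) <= a * b.
Proof. by move=> Xa Yb; apply: le_trans (sqFM X Y) _; rewrite ler_pM ?sqF_ge0. Qed.

Lemma sqF_isometry m n p (U : 'M[R]_(m, n)) (X : 'M[R]_(n, p)) :
  U^T *m U = 1%:M -> sqF (U *m X) = sqF X.
Proof. by move=> UU; rewrite /sqF trmx_mul mulmxA -(mulmxA X^T) UU mulmx1. Qed.

Lemma sqF_row_mx m n p (X : 'M[R]_(m, n)) (Y : 'M[R]_(m, p)) :
  sqF (row_mx X Y) = sqF X + sqF Y.
Proof.
rewrite !sqFE -big_split; apply: eq_bigr => i _; rewrite big_split_ord /=.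
by congr (_ + _); apply: eq_bigr => j _; rewrite ?row_mxEl ?row_mxEr.
Qed.

Lemma sqF_isometryr m n p (V : 'M[R]_(n, p)) (X : 'M[R]_(m, n)) :
  V *m V^T = 1%:M -> sqF (X *m V) = sqF X.
Proof. by move=> VV; rewrite -sqF_tr trmx_mul sqF_isometry ?trmxK// sqF_tr. Qed.

Definition orthoproj n (P : 'M[R]_n) : Prop := P^T = P /\ P *m P = P.

Lemma orthoprojC n (P : 'M[R]_n) : orthoproj P -> orthoproj (1%:M - P).
Proof.
move=> [PT PP]; split; first by rewrite linearB/= trmx1 PT.
by rewrite mulmxBr mulmx1 mulmxBl mul1mx PP subrr subr0.
Qed.

Lemma orthoproj_isometry n k (V : 'M[R]_(n, k)) :
  V^T *m V = 1%:M -> orthoproj (V *m V^T).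
Proof.
move=> VV; split; first by rewrite trmx_mul trmxK.
by rewrite mulmxA -(mulmxA V) VV mulmx1.
Qed.

Lemma sqF_orthoproj n (P : 'M[R]_n) : orthoproj P -> sqF P = \tr P.
Proof. by case=> PT PP; rewrite /sqF PT PP. Qed.

Lemma sqF_mulr_orthoproj m n (P : 'M[R]_n) (X : 'M[R]_(m, n)) : orthoproj P ->
  sqF (X *m P) = \tr (X^T *m X *m P).
Proof.
case=> PT PP; rewrite /sqF trmx_mul PT [LHS]mxtrace_mulC mulmxA -(mulmxA X) PP.
by rewrite [LHS]mxtrace_mulC mulmxA.
Qed.

Lemma sqF_mul_orthoproj n (P Q : 'M[R]_n) :
  orthoproj P -> orthoproj Q -> sqF (P *m Q) = \tr (P *m Q).
Proof. by move=> [PT PP] Qo; rewrite sqF_mulr_orthoproj// PT PP. Qed.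

Lemma sqF_pythagoras m n (P : 'M[R]_n) (X : 'M[R]_(m, n)) : orthoproj P ->
  sqF X = sqF (X *m P) + sqF (X *m (1%:M - P)).
Proof.
move=> Po; rewrite !sqF_mulr_orthoproj //; last exact: orthoprojC.
by rewrite -mxtraceD -mulmxDr addrC subrK mulmx1.
Qed.

Lemma sqF_orthoproj_le m n (P : 'M[R]_n) (X : 'M[R]_(m, n)) : orthoproj P ->
  sqF (X *m P) <= sqF X.
Proof. by move=> Po; rewrite (sqF_pythagoras X Po) lerDl sqF_ge0. Qed.

Lemma sqF_orthoprojl_le m n (P : 'M[R]_m) (X : 'M[R]_(m, n)) : orthoproj P ->
  sqF (P *m X) <= sqF X.
Proof.
by move=> Po; rewrite -sqF_tr trmx_mul (proj1 Po) -[sqF X]sqF_tr sqF_orthoproj_le.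
Qed.

(** Each projector absorbs the other on the right, P *m Q = P and Q *m P = Q, and
    transposing the first identity gives Q *m P = P. *)
Lemma orthoproj_eq n (P Q : 'M[R]_n) :
  orthoproj P -> orthoproj Q -> (P :=: Q)%MS -> P = Q.
Proof.
move=> [PT PP] [QT QQ] PQ.
have absorb (E F : 'M[R]_n) : F *m F = F -> (E <= F)%MS -> E *m F = E.
  by move=> FF /submxP[D ->]; rewrite -mulmxA FF.
have e1 : P *m Q = P by apply: absorb; rewrite // PQ.
have e2 : Q *m P = Q by apply: absorb; rewrite // -PQ.
by rewrite -[LHS]PT -e1 trmx_mul PT QT e2.
Qed.

(** Here P - Q is again a projector, so its squared norm is its trace. *)
Lemma orthoproj_trace_eq n (P Q : 'M[R]_n) :
  orthoproj P -> orthoproj Q -> (Q <= P)%MS -> \tr P <= \tr Q -> Q = P.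
Proof.
move=> Po Qo /submxP[D QD] PQ; have [PT PP] := Po; have [QT QQ] := Qo.
have QP : Q *m P = Q by rewrite QD -mulmxA PP.
have PQ' : P *m Q = Q by rewrite -{1}QT -{1}PT -trmx_mul QP QT.
apply/eqP; rewrite -subr_eq0; apply/eqP; apply: sqF_eq0.
rewrite /sqF [(_ - _)^T]linearB/= PT QT mulmxBl !mulmxBr QP PQ' QQ PP subrr sub0r.
by rewrite opprB linearB/= subr_le0.
Qed.

Lemma gram_unit k n (W : 'M[R]_(k, n)) : row_free W -> W *m W^T \in unitmx.
Proof.
move=> Wf; rewrite -row_free_unit -kermx_eq0; apply/eqP/row_matrixP => i.
set x := row i _; have xG : x *m (W *m W^T) = 0.
  by rewrite /x -row_mul mulmx_ker row0.
rewrite row0; have /eqP : x *m W = 0.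
  by apply: sqF_eq0; rewrite -sqF_tr /sqF trmxK trmx_mul mulmxA -(mulmxA x) xG mul0mx
    mxtrace0.
by rewrite mulmx_free_eq0 // => /eqP.
Qed.

(** The orthogonal projector onto the row space of a matrix with independent rows. *)
Definition rowproj k n (W : 'M[R]_(k, n)) : 'M[R]_n :=
  W^T *m invmx (W *m W^T) *m W.

Lemma rowprojP k n (W : 'M[R]_(k, n)) : row_free W ->
  [/\ orthoproj (rowproj W), W *m rowproj W = W,
      (rowproj W :=: W)%MS & \tr (rowproj W) = k%:R].
Proof.
move=> Wf; have Gu := gram_unit Wf.
have WP : W *m rowproj W = W by rewrite /rowproj !mulmxA mulmxV // mul1mx.
split=> //.
- split; first by rewrite /rowproj !trmx_mul trmxK trmx_inv trmx_mul trmxK mulmxA.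
  by rewrite {1}/rowproj -mulmxA WP.
- apply/eqmxP/andP; split; first exact: submxMl.
  by rewrite -{1}WP submxMl.
- by rewrite /rowproj mxtrace_mulC mulmxA mulmxV // mxtrace1.
Qed.

Lemma exists_rowproj m n (Y : 'M[R]_(m, n)) :
  exists Q, [/\ orthoproj Q, Y *m Q = Y & \tr Q = (\rank Y)%:R].
Proof.
have [Qo WQ QW trQ] := rowprojP (row_base_free Y).
exists (rowproj (row_base Y)); split=> //.
have /submxP[D YD] : (Y <= row_base Y)%MS by rewrite eq_row_base.
by rewrite [X in X *m _]YD -mulmxA WQ.
Qed.

(** By Pythagoras both sides are the common trace minus the squared norm of the
    product of P and Q. This is what makes the distance of two projectors of equal
    rank controllable from one side only: no lower bound on the singular values of a
    perturbed matrix enters. *)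
Lemma orthoproj_swap n (P Q : 'M[R]_n) : orthoproj P -> orthoproj Q ->
  \tr P = \tr Q -> sqF (P *m (1%:M - Q)) = sqF ((1%:M - P) *m Q).
Proof.
move=> Po Qo tPQ; have [PT _] := Po; have [QT _] := Qo; have [PcT _] := orthoprojC Po.
have sw (E F : 'M[R]_n) : E^T = E -> F^T = F -> sqF (E *m F) = sqF (F *m E).
  by move=> ET FT; rewrite -sqF_tr trmx_mul ET FT.
have := sqF_pythagoras Q Po; rewrite (sw Q) // [sqF (Q *m _)]sw //.
rewrite (sqF_orthoproj Qo) -tPQ -(sqF_orthoproj Po) (sqF_pythagoras P Qo).
by move=> /addrI.
Qed.
End SquaredNorm.

(** * Existence of singular value decompositions *)

Section SVDExistence.
Context {R : realType}.

Lemma sum_continuous (T : topologicalType) I (r : seq I) (F : I -> T -> R) :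
  (forall i, continuous (F i)) -> continuous (fun x => \sum_(i <- r) F i x).
Proof.
by move=> Fc; apply: continuous_big => // -[a b]; exact: add_continuous.
Qed.

Lemma sqF_mulmx_continuous m n p (X : 'M[R]_(n, p)) :
  continuous (fun v : 'M[R]_(m, n) => sqF (v *m X)).
Proof.
under eq_fun do rewrite sqFE.
do 2![apply: sum_continuous => ?].
under eq_fun do rewrite expr2 mxE.
have c i j : continuous (fun v : 'M[R]_(m, n) => \sum_l v i l * X l j).
  apply: sum_continuous => l v; apply: continuousM; last exact: cst_continuous.
  exact: coord_continuous.
by move=> v; apply: continuousM; exact: c.
Qed.

(** A maximizer of the stretch on the (compact) unit sphere; it is going to be a left
    singular vector for the largest singular value. *)
Lemma max_stretch m n (X : 'M[R]_(m.+1, n)) : exists v : 'rV_m.+1,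
  sqF v = 1 /\ forall w : 'rV_m.+1, sqF (w *m X) <= sqF (v *m X) * sqF w.
Proof.
pose A := [set v : 'rV[R]_m.+1 | sqF v = 1].
have [||| v /set_mem vA vmax] := @EVT_max_rV _ _ (fun v => sqF (v *m X)) A.
- exists (delta_mx 0 0); rewrite /A/= /sqF trmx_delta mul_delta_mx /mxtrace.
  rewrite (bigD1 ord0)//= mxE eqxx big1 ?addr0// => i i0.
  by rewrite mxE (negPf i0).
- apply: bounded_closed_compact.
    exists 1; split => // M M1 v vA; change (mx_norm v <= M); rewrite mx_normrE.
    apply/bigmax_leP; split=> [|[i j] _ /=]; first exact: ltW (lt_trans _ M1).
    apply: le_trans (ltW M1); rewrite -(@ler_pXn2r _ 2) ?nnegrE//.
    by rewrite expr1n -[_ ^+ 2]real_normK// normr_id -(vA : sqF v = 1) real_normK//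
      ?num_real// sqr_entry_le_sqF.
  rewrite (_ : A = (fun v => sqF (v *m 1%:M)) @^-1` [set 1]); last first.
    by apply/seteqP; split=> v /=; rewrite mulmx1.
  by apply: preimage_closed; [move=> v _; exact: sqF_mulmx_continuous|exact: closed_eq].
- exact: (continuous_subspaceT (@sqF_mulmx_continuous _ _ _ X)).
exists v; split=> // w.
have [w0|wN0] := leP (sqF w) 0.
  by rewrite (sqF_eq0 w0) mul0mx !sqF0 mulr0.
pose a := (Num.sqrt (sqF w))^-1.
have a2 : a ^+ 2 = (sqF w)^-1 by rewrite exprVn sqr_sqrtr // ltW.
have : sqF (a *: w *m X) <= sqF (v *m X).
  by apply: vmax; rewrite inE /A/= sqFZ a2 mulVf ?gt_eqF.
by rewrite -scalemxAl sqFZ a2 -ler_pdivlMl ?invr_gt0// invrK mulrC.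
Qed.

Lemma mulmx_tr_rV n (v : 'rV[R]_n) : v *m v^T = (sqF v)%:M.
Proof. by rewrite [LHS]mx11_scalar -sqF_tr /sqF trmxK /mxtrace big_ord1. Qed.

(** The Householder reflection exchanging v and the first basis vector e, that is,
    the reflection along w = v - e. *)
Lemma orthogonal_first_row n (v : 'rV[R]_n.+1) : sqF v = 1 ->
  exists H : 'M[R]_n.+1, H *m H^T = 1%:M /\ row 0 H = v.
Proof.
move=> v1; pose e : 'rV[R]_n.+1 := delta_mx 0 0; pose w := v - e.
have ee : e *m e^T = 1%:M.
  by rewrite trmx_delta mul_delta_mx; apply/matrixP => i j; rewrite !ord1 !mxE.
have rowE (H : 'M[R]_n.+1) : row 0 H = e *m H by rewrite rowE.
have [w0|wN0] := leP (sqF w) 0.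
  exists 1%:M; rewrite trmx1 mulmx1; split=> //.
  by rewrite rowE mulmx1; apply/esym/eqP; rewrite -subr_eq0; apply/eqP/sqF_eq0.
have ww := mulmx_tr_rV w; set q := sqF w in wN0 ww.
have vv := mulmx_tr_rV v; rewrite v1 in vv.
pose c := (e *m v^T) 0 0; have ev : e *m v^T = c%:M by rewrite [LHS]mx11_scalar.
have ve : v *m e^T = c%:M by rewrite -[LHS]trmxK trmx_mul trmxK ev tr_scalar_mx.
have qc : q = 2 - 2 * c.
  have /matrixP/(_ 0 0) := ww.
  rewrite /w [(_ - _)^T]linearB/= mulmxBl !mulmxBr vv ee ev ve !mxE !mulr1n.
  by move=> <-; ring.
have ewq : e *m w^T = (- (q / 2))%:M.
  rewrite /w [(_ - _)^T]linearB/= mulmxBr ev ee -raddfB/= qc; congr (_%:M).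
  by rewrite mulrBl mulrAC divff ?pnatr_eq0// mul1r opprB.
have q0 : q != 0 by rewrite gt_eqF.
pose N := w^T *m w; pose a := 2 / q.
have NT : N^T = N by rewrite trmx_mul trmxK.
have NN : N *m N = q *: N by rewrite mulmxA -(mulmxA w^T) ww mul_mx_scalar scalemxAl.
(* [a * q = 2] makes this an involution. *)
exists (1%:M - a *: N); split.
  rewrite [(_ - _)^T]linearB/= [(_ *: _)^T]linearZ/= trmx1 NT.
  rewrite mulmxBr mulmx1 mulmxBl mul1mx -scalemxAl -scalemxAr NN !scalerA.
  rewrite (_ : a * a * q = a + a); last by rewrite -mulrA divfK// mulr2n mulrDr mulr1.
  by rewrite scalerDl opprB addrK subrK.
rewrite rowE mulmxBr mulmx1 -scalemxAr /N mulmxA ewq mul_scalar_mx scalerA.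
have -> : a * - (q / 2) = -1 by rewrite mulrN /a mulrA divfK// divff ?pnatr_eq0.
by rewrite scaleN1r opprK /w addrC subrK.
Qed.

Lemma is_svd0 m n : is_svd (0 : 'M[R]_(m, n)) 1%:M (fun=> 0) 1%:M.
Proof.
split; rewrite ?trmx1 ?mulmx1//.
by apply/matrixP => i j; rewrite mul1mx !mxE if_same.
Qed.

(** If a matrix attains its maximal stretch a on the first basis vector, the rest of
    the first column vanishes: the row (a, c^T) has squared norm a^2 + |c|^2 and the
    first entry of its image is a^2 + |c|^2 as well, so |c|^2 (a^2 + |c|^2) <= 0. *)
Lemma stretch_first_column m n a (c : 'cV[R]_m) (M : 'M[R]_(m, n)) : 0 < a ->
  (forall w : 'rV_(1 + m), sqF (w *m block_mx a%:M 0 c M) <= a ^+ 2 * sqF w) ->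
  c = 0 /\ forall w : 'rV_m, sqF (w *m M) <= a ^+ 2 * sqF w.
Proof.
move=> a0 Mle; have c0 : c = 0.
  have cc : c^T *m c = (sqF c)%:M by rewrite -{2}(trmxK c) mulmx_tr_rV sqF_tr.
  have sq1 (b : R) : sqF (b%:M : 'M[R]_1) = b ^+ 2.
    by rewrite sqFE !big_ord1 mxE mulr1n.
  have := Mle (row_mx a%:M c^T); rewrite mul_row_block !sqF_row_mx sqF_tr sq1.
  rewrite -scalar_mxM cc -raddfD/= sq1 -expr2 => le1.
  apply: sqF_eq0; rewrite leNgt; apply/negP => q0.
  have a20 : 0 < a ^+ 2 by rewrite exprn_gt0.
  have := sqF_ge0 (a%:M *m 0 + c^T *m M); nra.
split=> // w; have := Mle (row_mx 0 w).
rewrite mul_row_block c0 !mul0mx !mulmx0 !add0r !sqF_row_mx !sqF0 !add0r.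
exact.
Qed.

(** Keeps the singular values ordered in the induction step of [svd_exists]. *)
Lemma singular_value_le_stretch m n (M : 'M[R]_(m, n)) U s V a : 0 <= a ->
  (forall w : 'rV_m, sqF (w *m M) <= a ^+ 2 * sqF w) ->
  is_svd M U s V -> s 1%N <= a.
Proof.
move=> a0 Mle [UU VV [s0 _] sz ME]; rewrite {M}ME in Mle.
have [mn|] := posnP (minn m n); first by rewrite sz// mn.
rewrite leq_min => /andP[m0 n0].
pose e : 'rV[R]_m := delta_mx 0 (Ordinal m0).
have e1 : sqF e = 1.
  by rewrite -sqF_tr /sqF trmxK trmx_delta mul_delta_mx /mxtrace big_ord1 mxE.
have := Mle (e *m U^T); rewrite !mulmxA -(mulmxA e) UU mulmx1.
rewrite (@sqF_isometryr _ _ _ _ V^T) ?trmxK// (@sqF_isometryr _ _ _ _ U^T) ?trmxK//.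
rewrite e1 mulr1 => le1.
rewrite -(@ler_pXn2r _ 2) ?nnegrE//; apply: le_trans le1.
by have := sqr_entry_le_sqF (e *m sv_mx s) 0 (Ordinal n0); rewrite -rowE !mxE.
Qed.

(** Deflation: orthogonal changes of basis that send a maximizing vector and its
    normalized image to the first basis vectors make the matrix block diagonal, with
    its norm as first entry, and the remaining block is smaller. *)
Theorem svd_exists m n (X : 'M[R]_(m, n)) : exists U s V, is_svd X U s V.
Proof.
elim: m n X => [|m IH] n X; first by exists 1%:M, (fun=> 0), 1%:M;
  rewrite (flatmx0 X); exact: is_svd0.
have [->|X0] := eqVneq X 0; first by exists 1%:M, (fun=> 0), 1%:M; exact: is_svd0.
case: n X X0 => [X|n X X0]; first by rewrite (thinmx0 X) eqxx.
have [v [v1 vX]] := max_stretch X; set q := sqF (v *m X) in vX.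
have q0 : 0 < q.
  rewrite lt_neqAle sqF_ge0 andbT; apply: contra X0 => /eqP q0.
  apply/eqP/row_matrixP => i; rewrite row0 rowE; apply: sqF_eq0.
  by rewrite (le_trans (vX _))// -q0 mul0r.
pose a := Num.sqrt q; have a0 : 0 < a by rewrite sqrtr_gt0.
have a2 : a ^+ 2 = q by rewrite sqr_sqrtr// ltW.
have [H [HH rH]] := orthogonal_first_row v1.
have [|K [KK rK]] := @orthogonal_first_row _ (a^-1 *: (v *m X)).
  by rewrite sqFZ exprVn a2 mulVf// gt_eqF.
pose M : 'M[R]_(1 + m, 1 + n) := H *m X *m K^T.
have XM : X = H^T *m M *m K.
  by rewrite /M !mulmxA (mulmx1C HH) mul1mx -mulmxA (mulmx1C KK) mulmx1.
have Mu : usubmx M = row_mx a%:M 0.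
  have -> : usubmx M = row 0 (M : 'M[R]_(m.+1, n.+1)).
    by apply/rowP => j; rewrite [LHS]mxE [RHS]mxE; congr (M _ _); exact: val_inj.
  rewrite /M !row_mul rH -[v *m X](@scalerKV _ _ a) ?gt_eqF// -scalemxAl.
  rewrite -rK -row_mul KK row1; apply/rowP => j; rewrite !mxE /= -val_eqE /=.
  by case: splitP => l /= ->; rewrite !mxE ?ord1 ?mulr1 ?mulr1n ?mulr0.
have Mb : M = block_mx a%:M 0 (dlsubmx M) (drsubmx M).
  by rewrite -{1}[M]vsubmxK Mu -{1}[dsubmx M]hsubmxK.
have Mle (w : 'rV[R]_(1 + m)) : sqF (w *m block_mx a%:M 0 (dlsubmx M) (drsubmx M)) <=
  a ^+ 2 * sqF w.
  rewrite -Mb /M !mulmxA sqF_isometryr ?trmxK ?(mulmx1C KK)// a2.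
  by apply: le_trans (vX _) _; rewrite sqF_isometryr.
have [c0 M'le] := stretch_first_column a0 Mle.
have [U [s [V sv]]] := IH _ (drsubmx M).
have s1a := singular_value_le_stretch (ltW a0) M'le sv.
have [UU VV [s0 smon] sz M'E] := sv.
pose t i := if i is j.+2 then s j.+1 else a.
clearbody M; exists (H^T *m (block_mx 1%:M 0 0 U : 'M[R]_(1 + m))), t,
  (K^T *m (block_mx 1%:M 0 0 V : 'M[R]_(1 + n))).
have blockO p (W : 'M[R]_p) (G : 'M[R]_(1 + p)) : W^T *m W = 1%:M -> G *m G^T = 1%:M ->
    (G^T *m block_mx 1%:M 0 0 W)^T *m (G^T *m block_mx 1%:M 0 0 W) = 1%:M.
  move=> WW GG; rewrite trmx_mul trmxK mulmxA -(mulmxA _ G) GG mulmx1.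
  by rewrite tr_block_mx !trmx0 trmx1 mulmx_block !mulmx0 !mul0mx mulmx1 WW !addr0
    add0r -scalar_mx_block.
split; [exact: blockO|exact: blockO| | |].
- split=> [[|[|i]]|[//|[|i]] [//|[|j]]] //=; rewrite ?(ltW a0)//.
  + by move=> _ _; apply: le_trans s1a; apply: smon.
  + by move=> _ ij; apply: smon.
- by case=> [|[|i]]; rewrite ?minnSS//= ltnS => ?; exact: sz.
rewrite XM trmx_mul trmxK !mulmxA; congr (_ *m _); rewrite -!mulmxA; congr (_ *m _).
have -> : sv_mx t = block_mx a%:M 0 0 (sv_mx s) :> 'M[R]_(1 + m, 1 + n).
  apply/matrixP => i j; rewrite !mxE.
  by case: splitP => k ->; rewrite !mxE; case: splitP => l ->;
    rewrite !mxE ?ord1//= ?mulr1n.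
suff -> : M = block_mx 1%:M 0 0 U *m (block_mx a%:M 0 0 (sv_mx s) *m
  (block_mx 1%:M 0 0 V)^T) by [].
rewrite tr_block_mx !trmx0 trmx1 !mulmx_block !mulmx0 !mul0mx !mulmx1 !mul1mx !addr0
  !add0r.
by rewrite mulmxA -M'E [LHS]Mb c0 mulmx0.
Qed.
End SVDExistence.

(** * Best low-rank approximation *)

Section Dominant.
Context {R : realType}.

Lemma orthoproj_conj n (V Q : 'M[R]_n) : V *m V^T = 1%:M ->
  orthoproj Q -> orthoproj (V^T *m Q *m V).
Proof.
move=> VV [QT QQ]; split; first by rewrite !trmx_mul trmxK QT mulmxA.
by rewrite !mulmxA -(mulmxA _ V) VV mulmx1 -(mulmxA V^T Q Q) QQ.
Qed.

Lemma orthoproj_diag n (Q : 'M[R]_n) i : orthoproj Q -> 0 <= Q i i <= 1.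
Proof.
move=> [QT QQ]; have Qii : Q i i = \sum_l Q i l ^+ 2.
  rewrite -{1}QQ mxE; apply: eq_bigr => l _.
  by rewrite expr2; congr (_ * _); rewrite -{1}QT mxE.
have Q0 : 0 <= Q i i by rewrite Qii sumr_ge0// => l _; exact: sqr_ge0.
have : Q i i ^+ 2 <= Q i i.
  by rewrite [leRHS]Qii (bigD1 i)//= lerDl sumr_ge0// => l _; exact: sqr_ge0.
by rewrite Q0/=; nra.
Qed.

Lemma dominant_isometry n k (V : 'M[R]_n) : (k <= n)%N -> V^T *m V = 1%:M ->
  (V *m pid_mx k : 'M[R]_(n, k))^T *m (V *m pid_mx k) = 1%:M.
Proof.
move=> kn VV; rewrite trmx_mul mulmxA -(mulmxA _ V^T) VV mulmx1 tr_pid_mx mul_pid_mx.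
by rewrite !minnn (minn_idPr kn) pid_mx_1.
Qed.

Lemma sv_mx_gram m n s : (forall i, (minn m n < i)%N -> s i = 0) ->
  (sv_mx s : 'M[R]_(m, n))^T *m sv_mx s = diag_mx (\row_j s j.+1 ^+ 2).
Proof.
move=> sz; apply/matrixP => j l; rewrite !mxE.
have [jm|mj] := ltnP j m.
  rewrite (bigD1 (Ordinal jm))//= big1 ?addr0; last first.
    by move=> i /eqP ij; rewrite !mxE; case: eqP => [ij'|]; rewrite ?mul0r//;
      case: ij; apply/val_inj.
  by rewrite !mxE/= eqxx -val_eqE/=; case: eqP => _; rewrite ?mulr1n ?mulr0.
rewrite big1 => [|i _].
  by rewrite (sz j.+1) ?expr0n ?mul0rn// ltnS geq_min mj.
by rewrite !mxE ltn_eqF ?mul0r// (leq_trans _ mj).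
Qed.

Lemma mulmx_pidE m n k (A : 'M[R]_(m, n)) i j :
  (A *m pid_mx k : 'M[R]_(m, n)) i j = A i j * (j < k)%:R.
Proof.
rewrite mxE (bigD1 j)//= big1 ?addr0 => [|l lj]; last by rewrite mxE val_eqE
  (negPf lj) mulr0.
by rewrite mxE eqxx.
Qed.

Lemma mxtrace_pid n k : (k <= n)%N -> \tr (pid_mx k : 'M[R]_n) = k%:R.
Proof.
move=> kn; have <- : (pid_mx k : 'M[R]_(n, k)) *m (pid_mx k : 'M[R]_(k, n)) = pid_mx k.
  by rewrite mul_pid_mx !minnn.
by rewrite mxtrace_mulC mul_pid_mx !minnn (minn_idPr kn) pid_mx_1 mxtrace1.
Qed.

Section EckartYoung.
Variables (m n k : nat) (X : 'M[R]_(m, n)) (U : 'M[R]_m) (s : nat -> R) (V : 'M[R]_n).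
Hypotheses (k_bounds : (1 <= k <= minn m n)%N) (svdX : is_svd X U s V).
Let P := (V *m pid_mx k : 'M[R]_(n, k)) *m (V *m pid_mx k : 'M[R]_(n, k))^T.

Lemma gram_svd : X^T *m X = V *m diag_mx (\row_j s j.+1 ^+ 2) *m V^T.
Proof.
have [UU VV _ sz ->] := svdX.
by rewrite !trmx_mul trmxK !mulmxA -(mulmxA _ U^T) UU mulmx1 -(mulmxA V _^T) sv_mx_gram.
Qed.

Lemma dominant_pid : V^T *m P *m V = pid_mx k.
Proof.
have [_ VV _ _ _] := svdX.
rewrite /P trmx_mul !mulmxA VV mul1mx -mulmxA VV mulmx1 tr_pid_mx mul_pid_mx.
by rewrite !minnn.
Qed.

(** In the basis V, with w j in [0, 1] the diagonal entries of Q, the right-hand side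
    is the sum over j of s j.+1 ^ 2 * ([j < k] - w j). Replacing s j.+1 by s k when
    j < k and by s k.+1 otherwise decreases every term. Keeping the left-hand side,
    instead of 0 for \tr Q <= k, is what gives uniqueness in [eckart_young_unique]. *)
Lemma trace_gap (Q : 'M[R]_n) : orthoproj Q ->
  s k ^+ 2 * (k%:R - \tr Q) + (s k ^+ 2 - s k.+1 ^+ 2) * \tr (Q *m (1%:M - P))
    <= sqF (X *m P) - sqF (X *m Q).
Proof.
move=> Qo; have [UU VV [s0 smon] sz _] := svdX.
have [k0 kmn] := andP k_bounds; have kn : (k <= n)%N := leq_trans kmn (geq_minr m n).
have VV' := mulmx1C VV.
have Po : orthoproj P by apply: orthoproj_isometry; exact: dominant_isometry.
have trV (A : 'M[R]_n) : \tr A = \tr (V^T *m A *m V).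
  by rewrite [RHS]mxtrace_mulC mulmxA VV' mul1mx.
pose T := V^T *m Q *m V.
have To : orthoproj T by apply: orthoproj_conj.
have trQ : \tr Q = \sum_j T j j by rewrite trV.
have trQP : \tr (Q *m (1%:M - P)) = \sum_j T j j * (k <= j)%:R.
  rewrite trV mulmxBr mulmx1 mulmxBr mulmxBl.
  have -> : V^T *m (Q *m P) *m V = T *m pid_mx k.
    by rewrite -dominant_pid /T 2!(mulmxA (V^T *m Q *m V)) -(mulmxA _ V V^T) VV'
      mulmx1 (mulmxA V^T Q P).
  apply: eq_bigr => j _; rewrite [LHS]mxE -/T [X in _ + X]mxE mulmx_pidE
    [(k <= j)%N]leqNgt.
  by case: (j < k)%N; rewrite /= ?mulr1 ?mulr0 ?subrr ?subr0.
have kE : k%:R = \sum_(j < n) (j < k)%:R :> R.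
  by rewrite -(mxtrace_pid kn) /mxtrace; apply: eq_bigr => j _; rewrite mxE eqxx.
have dE (A : 'M[R]_n) : orthoproj A ->
    sqF (X *m A) = \sum_(j < n) s j.+1 ^+ 2 * (V^T *m A *m V) j j.
  move=> Ao; rewrite sqF_mulr_orthoproj// gram_svd -!mulmxA mxtrace_mulC -!mulmxA.
  by rewrite mul_diag_mx; apply: eq_bigr => j _; rewrite [LHS]mxE [X in X * _]mxE.
rewrite !dE// dominant_pid -/T trQ trQP kE -!sumrB !mulr_sumr -big_split.
apply: ler_sum => j _ /=; rewrite [pid_mx _ _ _]mxE eqxx /=.
have /andP[T0 T1] := orthoproj_diag j To.
have dk0 : s k.+1 ^+ 2 <= s k ^+ 2 by rewrite ler_pXn2r ?nnegrE// smon.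
have [jk|kj] := ltnP j k.
  have d1 : s k ^+ 2 <= s j.+1 ^+ 2 by rewrite ler_pXn2r ?nnegrE// smon.
  rewrite /= !mulr0 mulr1 addr0; nra.
have d2 : s j.+1 ^+ 2 <= s k.+1 ^+ 2 by rewrite ler_pXn2r ?nnegrE// smon.
rewrite /= mulr0 mulr1 !sub0r; nra.
Qed.

Let Po : orthoproj P.
Proof.
have [_ VV _ _ _] := svdX; have [k0 kmn] := andP k_bounds.
apply: orthoproj_isometry; apply: dominant_isometry => //.
exact: leq_trans kmn (geq_minr m n).
Qed.

Lemma dominant_trace : \tr P = k%:R.
Proof.
have [_ VV _ _ _] := svdX; have [k0 kmn] := andP k_bounds.
rewrite mxtrace_mulC dominant_isometry ?mxtrace1//.
exact: leq_trans kmn (geq_minr m n).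
Qed.

Let s2_le : s k.+1 ^+ 2 <= s k ^+ 2.
Proof.
have [_ _ [s0 smon] _ _] := svdX; have [k0 _] := andP k_bounds.
by rewrite ler_pXn2r ?nnegrE// smon.
Qed.

(** With Q the projector onto the row space of Y, Pythagoras gives
    sqF (X - Y) >= sqF (X *m (1%:M - Q)) = sqF X - sqF (X *m Q), and [trace_gap] bounds
    sqF (X *m Q) by sqF (X *m P). *)
Theorem eckart_young (Y : 'M[R]_(m, n)) : (\rank Y <= k)%N ->
  sqF (X *m (1%:M - P)) <= sqF (X - Y).
Proof.
move=> Yk; have [Q [Qo YQ trQ]] := exists_rowproj Y.
have := trace_gap Qo; have := sqF_pythagoras X Po; have := sqF_pythagoras X Qo.
have := sqF_pythagoras (X - Y) Qo.
rewrite (mulmxBl X Y (1%:M - Q)) (mulmxBr Y 1%:M Q) mulmx1 YQ subrr subr0 trQ.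
have := sqF_ge0 ((X - Y) *m Q).
have Poc := orthoprojC Po.
have := sqF_ge0 (Q *m (1%:M - P)); rewrite sqF_mul_orthoproj//.
have : 0 <= s k ^+ 2 * (k%:R - (\rank Y)%:R).
  by rewrite mulr_ge0 ?sqr_ge0// subr_ge0 ler_nat.
move: s2_le; nra.
Qed.

(** For an optimal Y all inequalities in the proof of [eckart_young] are equalities,
    and the two terms of [trace_gap] force Q = P. *)
Theorem eckart_young_unique (Y : 'M[R]_(m, n)) : s k.+1 < s k ->
  (\rank Y <= k)%N -> sqF (X - Y) <= sqF (X *m (1%:M - P)) -> Y = X *m P.
Proof.
move=> gap Yk Ybest; have [Q [Qo YQ trQ]] := exists_rowproj Y.
have [_ _ [s0 _] _ _] := svdX.
have Poc := orthoprojC Po.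
have c0 : 0 < s k ^+ 2 by rewrite exprn_gt0// (le_lt_trans (s0 k.+1)).
have e0 : 0 < s k ^+ 2 - s k.+1 ^+ 2.
  by rewrite subr_gt0 ltr_pXn2r// nnegrE.
have kQ : 0 <= s k ^+ 2 * (k%:R - \tr Q).
  by rewrite mulr_ge0 ?sqr_ge0// subr_ge0 trQ ler_nat.
have QP : 0 <= (s k ^+ 2 - s k.+1 ^+ 2) * \tr (Q *m (1%:M - P)).
  by rewrite -sqF_mul_orthoproj// mulr_ge0 ?sqF_ge0// ltW.
have := trace_gap Qo; have := sqF_pythagoras X Po; have := sqF_pythagoras X Qo.
have := sqF_pythagoras (X - Y) Qo.
rewrite (mulmxBl X Y (1%:M - Q)) (mulmxBr Y 1%:M Q) mulmx1 YQ subrr subr0.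
have XYQ := sqF_ge0 ((X - Y) *m Q) => e1 e2 e3 e4.
have XYQ0 : sqF ((X - Y) *m Q) <= 0 by lra.
have : s k ^+ 2 * (k%:R - \tr Q) <= 0 by lra.
have : (s k ^+ 2 - s k.+1 ^+ 2) * \tr (Q *m (1%:M - P)) <= 0 by lra.
rewrite !pmulr_rle0// subr_le0 -sqF_mul_orthoproj// => /sqF_eq0.
rewrite mulmxBr mulmx1 => /eqP; rewrite subr_eq0 => /eqP QPE kQ'.
have -> : P = Q.
  apply/esym/orthoproj_trace_eq => //; last by rewrite dominant_trace.
  by rewrite QPE submxMl.
by move/sqF_eq0/eqP: XYQ0; rewrite mulmxBl YQ subr_eq0 => /eqP.
Qed.
End EckartYoung.
End Dominant.

(** * Projectors onto dominant singular subspaces and the Moore-Penrose inverse *)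

Section SingularProjectors.
Context {R : realType}.

(** The projector behind [P1]: the dominant singular vectors only enter through it. *)
Definition rightproj k m n (X : 'M[R]_(m, n)) : 'M[R]_n :=
  right_vectors k X *m (right_vectors k X)^T.

Definition leftproj k m n (X : 'M[R]_(m, n)) : 'M[R]_m :=
  left_vectors k X *m (left_vectors k X)^T.

Lemma P1E k m n (X Z : 'M[R]_(m, n)) : P1 k X Z = Z *m rightproj k X.
Proof. by rewrite /P1 -mulmxA. Qed.

Lemma P2E k m n (X Z : 'M[R]_(m, n)) : P2 k X Z = leftproj k X *m Z.
Proof. by []. Qed.

Lemma tr_sv_mx m n s : (sv_mx s : 'M[R]_(m, n))^T = sv_mx s.
Proof. by apply/matrixP => i j; rewrite !mxE eq_sym; case: eqP => // ->. Qed.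

Lemma is_svd_tr m n (X : 'M[R]_(m, n)) U s V : is_svd X U s V -> is_svd X^T V s U.
Proof.
move=> [UU VV s0 sz ->]; split=> //; first by move=> i; rewrite minnC; exact: sz.
by rewrite !trmx_mul trmxK tr_sv_mx mulmxA.
Qed.

Lemma leftprojE k m n (X : 'M[R]_(m, n)) : leftproj k X = rightproj k X^T.
Proof.
rewrite /leftproj /rightproj; suff -> : left_vectors k X = right_vectors k X^T by [].
congr (xget _ _); apply/seteqP; split=> W [U [s [V [svdX ->]]]].
  by exists V, s, U; split=> //; exact: is_svd_tr.
by exists V, s, U; split=> //; rewrite -[X]trmxK; exact: is_svd_tr.
Qed.

Section Rightproj.
Variables (k m n : nat).
Hypothesis k_bounds : (1 <= k <= minn m n)%N.
Let kn : (k <= n)%N.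
Proof. by have /andP[_ /leq_trans->//] := k_bounds; exact: geq_minr. Qed.

Lemma right_vectorsP (X : 'M[R]_(m, n)) : dominant_right X (right_vectors k X).
Proof.
rewrite /right_vectors; case: xgetP => [V _ //|/(_ _) none].
have [U [s [V svdX]]] := svd_exists X.
by case: (none (V *m pid_mx k)); exists U, s, V.
Qed.

Lemma right_vectors_isometry (X : 'M[R]_(m, n)) :
  (right_vectors k X)^T *m right_vectors k X = 1%:M.
Proof.
by have [U [s [V [[_ VV _ _ _] ->]]]] := right_vectorsP X; exact: dominant_isometry.
Qed.

Lemma rightproj_orthoproj (X : 'M[R]_(m, n)) : orthoproj (rightproj k X).
Proof. exact/orthoproj_isometry/right_vectors_isometry. Qed.

Lemma rightproj_trace (X : 'M[R]_(m, n)) : \tr (rightproj k X) = k%:R.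
Proof. by rewrite mxtrace_mulC right_vectors_isometry mxtrace1. Qed.

(** This holds for whichever dominant singular vectors were chosen. For X of rank k
    it makes the projector independent of that choice ([rightproj_unique]). *)
Lemma rightproj_best (X Y : 'M[R]_(m, n)) : (\rank Y <= k)%N ->
  sqF (X *m (1%:M - rightproj k X)) <= sqF (X - Y).
Proof.
have [U [s [V [svdX VE]]]] := right_vectorsP X.
by rewrite /rightproj VE; exact: eckart_young k_bounds svdX Y.
Qed.

(** Compare X with itself in [rightproj_best]. *)
Lemma mulmx_rightproj (X : 'M[R]_(m, n)) : (\rank X <= k)%N -> X *m rightproj k X = X.
Proof.
move=> Xk; have := rightproj_best X Xk; rewrite subrr sqF0 => /sqF_eq0.
by rewrite mulmxBr mulmx1 => /eqP; rewrite subr_eq0 => /eqP.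
Qed.

Lemma rightproj_eqmx (X : 'M[R]_(m, n)) : \rank X = k -> (rightproj k X :=: X)%MS.
Proof.
move=> Xk; have XP : (X <= rightproj k X)%MS.
  by rewrite -[Y in (Y <= _)%MS]mulmx_rightproj ?Xk ?submxMl.
apply/eqmx_sym/eqmxP; rewrite -mxrank_leqif_eq//.
rewrite eqn_leq mxrankS//= Xk.
by rewrite (leq_trans (mxrankM_maxr _ _))// rank_leq_row.
Qed.

Lemma rightproj_unique (X : 'M[R]_(m, n)) Q : \rank X = k ->
  orthoproj Q -> (Q :=: X)%MS -> rightproj k X = Q.
Proof.
move=> Xk Qo QX; apply: orthoproj_eq => //; first exact: rightproj_orthoproj.
exact: eqmx_trans (rightproj_eqmx Xk) (eqmx_sym QX).
Qed.

Lemma rightproj_rowproj (X : 'M[R]_(m, n)) (W : 'M[R]_(k, n)) : row_free W ->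
  (W :=: X)%MS -> rightproj k X = rowproj W.
Proof.
move=> Wf WX; have [Wo _ We _] := rowprojP Wf; apply: rightproj_unique => //.
  by rewrite -WX; exact/eqP.
exact: eqmx_trans We WX.
Qed.

End Rightproj.

Lemma isometry_row_free n k (V : 'M[R]_(n, k)) : V^T *m V = 1%:M -> row_free V^T.
Proof. by move=> VV; apply/row_freeP; exists V. Qed.

Lemma rowproj_isometry n k (V : 'M[R]_(n, k)) : V^T *m V = 1%:M ->
  rowproj V^T = V *m V^T.
Proof. by move=> VV; rewrite /rowproj trmxK VV invmx1 mulmx1. Qed.

Lemma penrose_full_rank_factorization m n r (C : 'M[R]_(m, r)) (W : 'M[R]_(r, n)) :
  row_free C^T -> row_free W ->
  penrose (C *m W) (W^T *m invmx (W *m W^T) *m (invmx (C^T *m C) *m C^T)).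
Proof.
move=> /gram_unit; rewrite trmxK => Cu /gram_unit Wu.
set G := invmx (W *m W^T); set H := invmx (C^T *m C).
have GT : G^T = G by rewrite trmx_inv trmx_mul trmxK.
have HT : H^T = H by rewrite trmx_inv trmx_mul trmxK.
have WG : W *m W^T *m G = 1%:M by rewrite mulmxV.
have HC : H *m (C^T *m C) = 1%:M by rewrite mulVmx.
have XY : C *m W *m (W^T *m G *m (H *m C^T)) = C *m H *m C^T.
  by rewrite -!mulmxA; congr (C *m _); rewrite !mulmxA WG mul1mx.
have YX : W^T *m G *m (H *m C^T) *m (C *m W) = W^T *m G *m W.
  by rewrite -!mulmxA; congr (_ *m (_ *m _)); rewrite !mulmxA -(mulmxA H) HC mul1mx.
split.
- by rewrite XY -!mulmxA; congr (_ *m _); rewrite !mulmxA -(mulmxA H) HC mul1mx.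
- by rewrite YX -!mulmxA; congr (_ *m (_ *m _)); rewrite !mulmxA WG mul1mx.
- by rewrite XY !trmx_mul trmxK HT mulmxA.
- by rewrite YX !trmx_mul trmxK GT mulmxA.
Qed.

Lemma penrose_exists m n (X : 'M[R]_(m, n)) : exists Y, penrose X Y.
Proof.
rewrite -(mulmx_base X); eexists; apply: penrose_full_rank_factorization.
  by rewrite /row_free mxrank_tr; have := col_base_full X.
exact: row_base_free.
Qed.

Lemma mp_invP m n (X : 'M[R]_(m, n)) : penrose X (mp_inv X).
Proof.
rewrite /mp_inv; case: xgetP => [Y _ //|none].
by have [Y XY] := penrose_exists X; case: (none Y).
Qed.

Lemma rightproj_mp_inv k m n (X : 'M[R]_(m, n)) : (1 <= k <= minn m n)%N ->
  \rank X = k -> rightproj k X = mp_inv X *m X.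
Proof.
move=> kb Xk; have [XYX YXY XYT YXT] := mp_invP X.
apply: rightproj_unique => //; first by split=> //; rewrite mulmxA YXY.
by apply/eqmxP/andP; split; rewrite ?submxMl// -{1}XYX -mulmxA submxMl.
Qed.

Lemma leftproj_mp_inv k m n (X : 'M[R]_(m, n)) : (1 <= k <= minn m n)%N ->
  \rank X = k -> leftproj k X = X *m mp_inv X.
Proof.
move=> kb Xk; have [XYX YXY XYT YXT] := mp_invP X; rewrite leftprojE.
apply: rightproj_unique => //; first by rewrite minnC.
- by rewrite mxrank_tr.
- by split=> //; rewrite mulmxA XYX.
apply/eqmxP/andP; split; first by rewrite -XYT trmx_mul submxMl.
by rewrite -{1}XYX trmx_mul XYT submxMl.
Qed.

End SingularProjectors.

(** * Alternating projection is simultaneous orthogonal iteration *)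

Section SimultaneousIteration.
Context {R : realType}.

(** As rank is not lost, the column space of S1 k B X is that of B *m V, hence of U,
    so that Smap k B X = U U^T B = U (B^T U)^T. *)
Lemma orthogonal_iteration_step (k m n : nat) (B X : 'M[R]_(m, n))
    (U : 'M[R]_(m, k)) (S T : 'M[R]_k) (V V' : 'M[R]_(n, k)) :
  (1 <= k <= minn m n)%N -> rightproj k X = V *m V^T -> V^T *m V = 1%:M ->
  \rank (S1 k B X) = k -> tall_qr (B *m V) U T -> tall_qr (B^T *m U) V' S^T ->
  Smap k B X = U *m S *m V'^T.
Proof.
move=> kb XV VV rk [UU _ BV] [VV' _ BU].
have XhE : S1 k B X = U *m T *m V^T by rewrite /S1 P1E XV mulmxA BV.
rewrite /Smap /= /S2 P2E leftprojE.
have -> : rightproj k (S1 k B X)^T = U *m U^T.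
  rewrite -rowproj_isometry//; apply: rightproj_rowproj; first by rewrite minnC.
    exact: isometry_row_free.
  apply/eqmx_sym/eqmxP; rewrite -mxrank_leqif_eq.
    by rewrite mxrank_tr rk eq_sym; exact: isometry_row_free.
  by rewrite XhE !trmx_mul mulmxA submxMl.
by rewrite -mulmxA -(mulmxA U); congr (_ *m _); rewrite -[LHS]trmxK trmx_mul trmxK BU
  trmx_mul trmxK.
Qed.

(** By induction, V l is an orthonormal basis of the row space of X l. *)
Theorem orthogonal_iterationE (k m n : nat) (B : 'M[R]_(m, n)) X0
    (U : nat -> 'M[R]_(m, k)) (T : nat -> 'M[R]_k) (V : nat -> 'M[R]_(n, k)) :
  (1 <= k <= minn m n)%N ->
  orthogonal_iteration B U T V -> ((V 0%N)^T == X0)%MS ->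
  let X l := iter l (Smap k B) X0 in
  forall L : nat, (forall l, (l <= L)%N -> \rank (X l) = k) ->
  (forall l, (l < L)%N -> \rank (S1 k B (X l)) = k) ->
  forall l, (1 <= l <= L)%N -> X l = U l *m T l *m (V l)^T.
Proof.
move=> kb [VV0 run] V0X X L rX rXh.
have VV l : (V l)^T *m V l = 1%:M by case: l => [//|l]; have [_ []] := run l.
suff main l : (l <= L)%N -> rightproj k (X l) = V l *m (V l)^T /\
    ((1 <= l)%N -> X l = U l *m T l *m (V l)^T).
  by move=> l /andP[l0 /main[_]]; exact.
elim: l => [_|l IH lL].
  split=> //; rewrite -rowproj_isometry//; apply: rightproj_rowproj => //.
    exact: isometry_row_free.
  exact/eqmxP.
have [XV _] := IH (ltnW lL); have [[t qr1] qr2] := run l.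
have XE : X l.+1 = U l.+1 *m T l.+1 *m (V l.+1)^T.
  by rewrite /X iterS; apply: orthogonal_iteration_step XV (VV l) _ qr1 qr2;
    rewrite ?rXh.
split=> // {IH}; rewrite -rowproj_isometry//; apply: rightproj_rowproj => //.
  exact: isometry_row_free.
apply/eqmx_sym/eqmxP; rewrite -mxrank_leqif_eq; last by rewrite XE submxMl.
by rewrite rX// eq_sym; exact: isometry_row_free.
Qed.

End SimultaneousIteration.

(** * The truncated singular value decomposition of B *)

Section TruncatedSvdTheory.
Context {R : realType}.

(** What the analysis uses about B and its best approximation Xb: U1 and V1 hold the
    dominant singular vectors, D the dominant singular values and Di their inverses.
    The redundancy makes the record symmetric under transposition
    ([truncated_svd_tr]), which gives every statement about row spaces a counterpart
    about column spaces. *)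
Record truncated_svd k m n (B Xb : 'M[R]_(m, n)) (s : nat -> R)
  (U : 'M[R]_m) (V : 'M[R]_n) (U1 : 'M[R]_(m, k)) (V1 : 'M[R]_(n, k))
  (D Di : 'M[R]_k) : Prop := TruncatedSvd {
  tsvd_bounds : (1 <= k <= minn m n)%N;
  tsvd_svd : is_svd B U s V;
  tsvd_gap : s k.+1 < s k;
  tsvd_UU : U1^T *m U1 = 1%:M;
  tsvd_VV : V1^T *m V1 = 1%:M;
  tsvd_D : D = diag_mx (\row_j s j.+1);
  tsvd_Di : Di = diag_mx (\row_j (s j.+1)^-1);
  tsvd_DDi : D *m Di = 1%:M;
  tsvd_BV : B *m V1 = U1 *m D;
  tsvd_BU : B^T *m U1 = V1 *m D;
  tsvd_X : Xb = U1 *m D *m V1^T;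
  tsvd_rest : B - Xb = U *m sv_mx (fun i => if (i <= k)%N then 0 else s i) *m V^T }.

Lemma best_rank_approxE k m n (B Y : 'M[R]_(m, n)) U s V : (1 <= k <= minn m n)%N ->
  is_svd B U s V -> s k.+1 < s k -> best_rank_approx k B Y ->
  Y = B *m ((V *m pid_mx k : 'M[R]_(n, k)) *m (V *m pid_mx k : 'M[R]_(n, k))^T).
Proof.
move=> kb svdB gap [Yk Ybest]; apply: (eckart_young_unique kb svdB gap) => //.
set P := (X in 1%:M - X); rewrite -sqFN opprB -[leRHS]sqFN mulmxBr mulmx1 opprB.
rewrite -ler_sqrt ?sqF_ge0//; apply: Ybest.
by rewrite /P !mulmxA (leq_trans (mxrankM_maxr _ _))// rank_leq_row.
Qed.

Lemma truncated_svd_exists k m n (B Xb : 'M[R]_(m, n)) s : (1 <= k <= minn m n)%N ->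
  singular_values B s -> s k.+1 < s k -> best_rank_approx k B Xb ->
  exists U V U1 V1 D Di, @truncated_svd k m n B Xb s U V U1 V1 D Di.
Proof.
move=> kb [U [V svdB]] gap Xbest.
have [/andP[k1 kmn] [UU VV [s0 smon] sz BE]] := (kb, svdB).
have [km kn] : (k <= m /\ k <= n)%N by apply/andP; rewrite -leq_min.
set U1 := U *m pid_mx k : 'M[R]_(m, k); set V1 := V *m pid_mx k : 'M[R]_(n, k).
pose D : 'M[R]_k := diag_mx (\row_j s j.+1).
pose Di : 'M[R]_k := diag_mx (\row_j (s j.+1)^-1).
have pid_sv p q : (k <= p)%N -> (k <= q)%N ->
    (sv_mx s : 'M[R]_(p, q)) *m pid_mx k = (pid_mx k : 'M[R]_(p, k)) *m D.
  move=> kp kq; apply/matrixP => i j; rewrite mul_mx_diag !mxE.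
  rewrite (bigD1 (widen_ord kq j))//= big1 ?addr0 => [|l lj]; last first.
    by rewrite [X in _ * X]mxE; case: eqP => [lj'|]; rewrite ?mulr0//; case/eqP: lj;
      apply/val_inj.
  rewrite !mxE/= eqxx ltn_ord/= mulr1.
  by case: eqP => [->|_]; rewrite /= ?ltn_ord ?mul1r ?mul0r.
have BV : B *m V1 = U1 *m D.
  by rewrite BE /V1 mulmxA -(mulmxA _ V^T) VV mulmx1 -mulmxA pid_sv // mulmxA.
have BU : B^T *m U1 = V1 *m D.
  rewrite BE !trmx_mul trmxK /U1 tr_sv_mx !mulmxA -(mulmxA _ U^T U) UU mulmx1.
  by rewrite -mulmxA pid_sv // mulmxA.
have UU1 : U1^T *m U1 = 1%:M by apply: dominant_isometry.
have VV1 : V1^T *m V1 = 1%:M by apply: dominant_isometry.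
have XbE : Xb = B *m (V1 *m V1^T) by exact: best_rank_approxE kb svdB gap Xbest.
exists U, V, U1, V1, D, Di; split=> //.
- rewrite /D /Di mulmx_diag -diag_const_mx; congr diag_mx; apply/rowP => j;
  rewrite !mxE divff//.
  rewrite gt_eqF// (lt_le_trans (le_lt_trans (s0 k.+1) gap))//.
  by apply: smon.
- by rewrite XbE mulmxA BV.
have -> : B - Xb = U *m (sv_mx s - sv_mx s *m (pid_mx k : 'M[R]_n)) *m V^T.
  rewrite XbE mulmxBr mulmxBl -BE; congr (_ - _); rewrite BE /V1 trmx_mul tr_pid_mx.
  rewrite -!mulmxA; do 2!congr (_ *m _); rewrite mulmxA VV mul1mx mulmxA.
  by rewrite mul_pid_mx !minnn.
congr (_ *m _ *m _); apply/matrixP => i j; rewrite [LHS]mxE [X in _ + X]mxE mulmx_pidE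
  !mxE.
by case: eqP => [->|_]; case: ltnP => _; rewrite ?mulr0 ?mulr1 ?mul0r ?subrr ?subr0.
Qed.

Section RightSide.
Variables (k m n : nat) (B Xb : 'M[R]_(m, n)) (s : nat -> R) (U : 'M[R]_m) (V : 'M[R]_n)
   (U1 : 'M[R]_(m, k)) (V1 : 'M[R]_(n, k)) (D Di : 'M[R]_k).
Hypothesis T : truncated_svd B Xb s U V U1 V1 D Di.
Let UU := tsvd_UU T.
Let VV := tsvd_VV T.
Let DDi := tsvd_DDi T.
Let DiD : Di *m D = 1%:M := mulmx1C DDi.
Let kb := tsvd_bounds T.

Lemma tsvd_DT : D^T = D. Proof. by rewrite (tsvd_D T) tr_diag_mx. Qed.
Lemma tsvd_DiT : Di^T = Di. Proof. by rewrite (tsvd_Di T) tr_diag_mx. Qed.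

Lemma tsvd_sk_gt0 : 0 < s k.
Proof. by have [_ _ [s0 _] _ _] := tsvd_svd T; exact: le_lt_trans (s0 _) (tsvd_gap T).
  Qed.

Lemma truncated_svd_tr : truncated_svd B^T Xb^T s V U V1 U1 D Di.
Proof.
case: T => kb' svd gap ? ? ? ? ? BV BU XE rest; split=> //.
- by rewrite minnC.
- exact: is_svd_tr.
- by rewrite trmxK.
- by rewrite XE !trmx_mul trmxK tsvd_DT mulmxA.
- by rewrite -linearB/= rest !trmx_mul trmxK tr_sv_mx mulmxA.
Qed.

Lemma tsvd_BP : B *m (V1 *m V1^T) = Xb.
Proof. by rewrite mulmxA (tsvd_BV T) (tsvd_X T). Qed.

(** The Moore-Penrose inverse of Xb, in coordinates. *)
Definition pinv : 'M[R]_(n, m) := V1 *m Di *m U1^T.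

Lemma pinvX : pinv *m Xb = V1 *m V1^T.
Proof.
by rewrite /pinv (tsvd_X T) !mulmxA -(mulmxA _ U1^T) UU mulmx1 -(mulmxA V1) DiD mulmx1.
Qed.

Lemma tsvd_rank : \rank Xb = k.
Proof.
apply/eqP; rewrite eqn_leq; apply/andP; split.
  by rewrite (tsvd_X T) (leq_trans (mxrankM_maxr _ _))// rank_leq_row.
rewrite (leq_trans _ (mxrankM_maxr pinv Xb))// pinvX mxrankMfree ?isometry_row_free//.
by rewrite -mxrank_tr (eqP (isometry_row_free VV)).
Qed.

Lemma rightprojX : rightproj k Xb = V1 *m V1^T.
Proof.
rewrite -rowproj_isometry//; apply: rightproj_rowproj kb _ _ _ _.
  exact: isometry_row_free.
apply/eqmx_sym/eqmxP; rewrite -mxrank_leqif_eq ?(tsvd_X T) ?submxMl//.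
by rewrite -(tsvd_X T) tsvd_rank eq_sym; exact: isometry_row_free.
Qed.

Lemma mulP_pinv : V1 *m V1^T *m pinv = pinv.
Proof. by rewrite /pinv !mulmxA -(mulmxA V1 _^T) VV mulmx1. Qed.

Lemma rest_V1 : (B - Xb) *m V1 = 0.
Proof. by rewrite mulmxBl (tsvd_BV T) (tsvd_X T) -(mulmxA _ V1^T) VV mulmx1 subrr. Qed.

Lemma pinvB : pinv *m B = V1 *m V1^T.
Proof.
rewrite /pinv -mulmxA -[U1^T *m B]trmxK trmx_mul trmxK (tsvd_BU T) trmx_mul tsvd_DT.
by rewrite !mulmxA -(mulmxA V1) DiD mulmx1.
Qed.

Let s2 i := if (i <= k)%N then 0 else s i.

Lemma gram_rest :
  (B - Xb)^T *m (B - Xb) = V *m diag_mx (\row_j s2 j.+1 ^+ 2) *m V^T.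
Proof.
have [UU' _ _ sz _] := tsvd_svd T.
rewrite (tsvd_rest T) !trmx_mul trmxK !mulmxA -(mulmxA _ U^T) UU' mulmx1.
rewrite -(mulmxA V _^T) sv_mx_gram // => i mni; rewrite sz ?if_same//.
Qed.

(** The remainder B - Xb has the singular values s k.+1, s k.+2, ... *)
Lemma sqF_mul_rest p (Z : 'M[R]_(p, n)) :
  sqF (Z *m (B - Xb)^T) <= s k.+1 ^+ 2 * sqF Z.
Proof.
have [_ VV' [s0 smon] _ _] := tsvd_svd T.
rewrite -[sqF Z](@sqF_isometryr _ _ _ _ V); last exact: mulmx1C.
have -> : sqF (Z *m (B - Xb)^T) = \sum_(j < n) s2 j.+1 ^+ 2 * ((Z *m V)^T *m (Z *m V))
  j j.
  rewrite -sqF_tr trmx_mul trmxK /sqF trmx_mul trmxK -mulmxA (mulmxA (B - Xb)^T)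
    gram_rest.
  rewrite -!mulmxA mxtrace_mulC -!mulmxA mxtrace_mulC trmx_mul -!mulmxA mul_diag_mx.
  by apply: eq_bigr => j _; rewrite [LHS]mxE [X in X * _]mxE.
rewrite /sqF /mxtrace mulr_sumr; apply: ler_sum => j _.
apply: ler_wpM2r.
  by rewrite mxE sumr_ge0// => l _; rewrite mxE -expr2 sqr_ge0.
rewrite /s2; case: ltnP => /= kj; first by rewrite expr0n/= sqr_ge0.
by rewrite ler_pXn2r ?nnegrE// smon.
Qed.

Lemma sqF_mul_Di p (Z : 'M[R]_(k, p)) : sqF (Di *m Z) <= (s k)^-1 ^+ 2 * sqF Z.
Proof.
have [_ _ [s0 smon] _ _] := tsvd_svd T; have s_gt0 := tsvd_sk_gt0.
rewrite (tsvd_Di T) mul_diag_mx !sqFE mulr_sumr; apply: ler_sum => i _.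
rewrite mulr_sumr; apply: ler_sum => j _; rewrite !mxE exprMn ler_wpM2r ?sqr_ge0//.
have sks : s k <= s i.+1 by apply: smon.
rewrite ler_pXn2r ?nnegrE ?invr_ge0// lef_pV2 ?posrE// (lt_le_trans s_gt0)//.
Qed.

End RightSide.

Section LeftSide.
Variables (k m n : nat) (B Xb : 'M[R]_(m, n)) (s : nat -> R) (U : 'M[R]_m) (V : 'M[R]_n)
   (U1 : 'M[R]_(m, k)) (V1 : 'M[R]_(n, k)) (D Di : 'M[R]_k).
Hypothesis T : truncated_svd B Xb s U V U1 V1 D Di.
Let T' := truncated_svd_tr T.
Let G := pinv U1 V1 Di.

Lemma pinv_tr : pinv V1 U1 Di = G^T.
Proof. by rewrite /G /pinv !trmx_mul trmxK (tsvd_DiT T) mulmxA. Qed.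

Lemma leftprojX : leftproj k Xb = U1 *m U1^T.
Proof. by rewrite leftprojE (rightprojX T'). Qed.

Lemma Xpinv : Xb *m G = U1 *m U1^T.
Proof. by have := congr1 trmx (pinvX T'); rewrite pinv_tr !trmx_mul !trmxK. Qed.

Lemma pinv_mulP : G *m (U1 *m U1^T) = G.
Proof. by have := congr1 trmx (mulP_pinv T'); rewrite pinv_tr !trmx_mul !trmxK. Qed.

Lemma U1_rest : U1^T *m (B - Xb) = 0.
Proof.
have := congr1 trmx (rest_V1 T'); rewrite -linearB/= trmx_mul trmxK trmx0.
exact.
Qed.

Lemma Bpinv : B *m G = U1 *m U1^T.
Proof. by have := congr1 trmx (pinvB T'); rewrite pinv_tr !trmx_mul !trmxK. Qed.

Lemma tsvd_PB : U1 *m U1^T *m B = Xb.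
Proof. by have := congr1 trmx (tsvd_BP T'); rewrite !trmx_mul !trmxK. Qed.

End LeftSide.

End TruncatedSvdTheory.

(** * First-order perturbation of singular projectors *)

Lemma addmxE (V : nmodType) m n (A A' : 'M[V]_(m, n)) i j :
  (A + A') i j = A i j + A' i j.
Proof. by rewrite mxE. Qed.

Lemma oppmxE (V : zmodType) m n (A : 'M[V]_(m, n)) i j : (- A) i j = - A i j.
Proof. by rewrite mxE. Qed.

(** Proves identities between sums of matrix products, each product being an atom. *)
Ltac entrywise_ring := apply/matrixP => ? ?; rewrite !(addmxE, oppmxE); ring.

Section Perturbation.
Context {R : realFieldType}.

(** Since G *m X0 is symmetric, (1%:M - P) *m (G *m X0) = (1%:M - P) *m X0^T *m G^T;
    write X0 = X - (X - X0) and use the hypothesis on the first part. Applied to the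
    dominant projector P of X, the hypothesis is the Eckart-Young inequality. *)
Lemma residual_bound m n (X X0 : 'M[R]_(m, n)) (G : 'M[R]_(n, m)) (P : 'M[R]_n) :
  orthoproj (G *m X0) -> orthoproj P ->
  sqF (X *m (1%:M - P)) <= sqF (X - X0) ->
  sqF ((1%:M - P) *m (G *m X0)) <= 4 * (sqF (X - X0) * sqF G).
Proof.
move=> [P0T _] Po Xle; have Qo := orthoprojC Po; have [QT _] := Qo.
have -> : (1%:M - P) *m (G *m X0) =
    (X *m (1%:M - P))^T *m G^T - (1%:M - P) *m (X - X0)^T *m G^T.
  rewrite -P0T !trmx_mul QT [(X - X0)^T]linearB/= !(mulmxBr, mulmxBl) !mulmxA.
  entrywise_ring.
apply: le_trans (sqFD _ _) _; rewrite sqFN.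
have h1 : sqF ((X *m (1%:M - P))^T *m G^T) <= sqF (X - X0) * sqF G.
  by apply: sqFM_le; rewrite sqF_tr.
have h2 : sqF ((1%:M - P) *m (X - X0)^T *m G^T) <= sqF (X - X0) * sqF G.
  apply: sqFM_le; last by rewrite sqF_tr.
  by rewrite -[leRHS]sqF_tr sqF_orthoprojl_le.
lra.
Qed.

(** With Q = 1%:M - P, P0 = G *m X0, and E = X - X0, the difference P - P0 equals
    P *m Q0 - Q *m P0, and both terms are of order E by [residual_bound] and
    [orthoproj_swap]. The second is Q X^T G^T - Q E^T G^T. In its first part Q X^T is of
    order E and is multiplied by (1%:M - P') (X0 G), again of order E; in its second
    part Q may be replaced by Q0. So Q *m P0 = - Q0 E^T G^T up to second order. The
    first term differs from its part P0 P Q0 = - (Q P0)^T Q0 by (P Q0)^T (P Q0), which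
    is of second order. *)
Lemma projector_first_order m n (X X0 : 'M[R]_(m, n)) (G : 'M[R]_(n, m))
    (P : 'M[R]_n) (P' : 'M[R]_m) :
  let E := X - X0 in let Q0 := 1%:M - G *m X0 in
  orthoproj (G *m X0) -> orthoproj (X0 *m G) -> G *m X0 *m G = G ->
  orthoproj P -> orthoproj P' -> \tr P = \tr (G *m X0) ->
  X *m P = P' *m X ->
  sqF (X *m (1%:M - P)) <= sqF E ->
  sqF (P - G *m X0 - (G *m E *m Q0 + Q0 *m E^T *m G^T))
    <= 304%:R * (sqF G) ^+ 2 * (sqF E) ^+ 2.
Proof.
move=> E Q0 P0o P0o' GXG Po Po' trP XP Xle.
have Qo := orthoprojC Po; have Q0o := orthoprojC P0o; have Qo' := orthoprojC Po'.
have [P0T P00] := P0o; have [P0T' _] := P0o'; have [QT QQ] := Qo; have [PT PP] := Po.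
have GT' : (X0 *m G) *m G^T = G^T by rewrite -P0T' -trmx_mul mulmxA GXG.
have g0 := sqF_ge0 G; have e0 := sqF_ge0 E.
have XQ : X *m (1%:M - P) = (1%:M - P') *m X.
  by rewrite mulmxBr mulmxBl mulmx1 mul1mx XP.
have QP0 : sqF ((1%:M - P) *m (G *m X0)) <= 4 * (sqF E * sqF G).
  exact: residual_bound.
have QP0' : sqF ((1%:M - P') *m (X0 *m G)) <= 4 * (sqF E * sqF G).
  have := @residual_bound _ _ X^T X0^T G^T P'.
  rewrite -!trmx_mul P0T' -linearB/= !sqF_tr; apply=> //.
  by rewrite -sqF_tr trmx_mul trmxK (proj1 Qo') -XQ.
have PQ0 : sqF (P *m Q0) <= 4 * (sqF E * sqF G) by rewrite orthoproj_swap.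
have PP0 : sqF (P - G *m X0) <= 16%:R * (sqF E * sqF G).
  have -> : P - G *m X0 = P *m Q0 + - ((1%:M - P) *m (G *m X0)).
    rewrite mulmxBr mulmx1 mulmxBl mul1mx; entrywise_ring.
  apply: le_trans (sqFD _ _) _; rewrite sqFN; lra.
pose R1 := (1%:M - P) *m (G *m X0) + Q0 *m E^T *m G^T.
have R1E : R1 = (X *m (1%:M - P))^T *m ((1%:M - P') *m (X0 *m G)) *m G^T
              + (P - G *m X0) *m E^T *m G^T.
  rewrite XQ trmx_mul (proj1 Qo') mulmxA -(mulmxA X^T) (proj2 Qo').
  rewrite -(mulmxA _ _ G^T) GT' -{1}(proj1 Qo') -trmx_mul -XQ trmx_mul QT /R1.
  have P0E : G *m X0 = X^T *m G^T - E^T *m G^T.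
    by rewrite -P0T trmx_mul [E^T]linearB/= mulmxBl opprB addrC subrK.
  rewrite [X in _ *m X + _]P0E /Q0 !(mulmxBr, mulmxBl, mul1mx) !mulmxA.
  entrywise_ring.
(* The summands of [R1E] contribute 4 and 16, and [sqFD] doubles: 2 * 4 + 2 * 16. *)
have R1le : sqF R1 <= 40%:R * (sqF G) ^+ 2 * (sqF E) ^+ 2.
  rewrite R1E; apply: le_trans (sqFD _ _) _.
  have h1 : sqF ((X *m (1%:M - P))^T *m ((1%:M - P') *m (X0 *m G)) *m G^T)
      <= sqF E * (4 * (sqF E * sqF G)) * sqF G.
    by do 2?[apply: sqFM_le]; rewrite ?sqF_tr.
  have h2 : sqF ((P - G *m X0) *m E^T *m G^T) <= 16%:R * (sqF E * sqF G) * sqF E * sqF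
    G.
    by do 2?[apply: sqFM_le]; rewrite ?sqF_tr.
  lra.
(* By [sqFD] twice, the constant is 2 * (2 * 40 + 2 * 16) + 2 * 40 = 304. *)
have -> : P - G *m X0 - (G *m E *m Q0 + Q0 *m E^T *m G^T) =
   (- (R1^T *m Q0) + (P *m Q0)^T *m (P *m Q0)) + - R1.
  have Q0T : Q0^T = Q0 := proj1 Q0o; have Q0Q0 : Q0 *m Q0 = Q0 := proj2 Q0o.
  have -> : R1^T *m Q0 = G *m E *m Q0 - G *m X0 *m P *m Q0.
    rewrite /R1 [(_ + _)^T]linearD/= !trmx_mul !trmxK QT Q0T -trmx_mul P0T mulmxDl.
    rewrite !mulmxA -(mulmxA _ Q0 Q0) Q0Q0 addrC; congr (_ + _).
    rewrite [_ *m (1%:M - P)]mulmxBr mulmx1 mulmxBl {1}/Q0 mulmxBr mulmx1.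
    by rewrite P00 subrr sub0r.
  rewrite [(P *m Q0)^T]trmx_mul Q0T PT -(mulmxA Q0 P) (mulmxA P P) PP /R1.
  rewrite {3}/Q0 !(mulmxBl, mul1mx) /Q0 !(mulmxBr, mulmx1) !mulmxA.
  entrywise_ring.
have h3 : sqF (- (R1^T *m Q0)) <= 40%:R * (sqF G) ^+ 2 * (sqF E) ^+ 2.
  by rewrite sqFN (le_trans (sqF_orthoproj_le _ Q0o))// sqF_tr.
have h4 : sqF ((P *m Q0)^T *m (P *m Q0)) <= 4 * (sqF E * sqF G) * (4 * (sqF E * sqF G)).
  by apply: sqFM_le; rewrite ?sqF_tr.
apply: le_trans (sqFD _ _) _; rewrite [sqF (- R1)]sqFN.
have := sqFD (- (R1^T *m Q0)) ((P *m Q0)^T *m (P *m Q0)).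
lra.
Qed.
End Perturbation.

(** * Comparison of norms and a differentiability criterion *)

Section NormComparison.
Context {R : realType}.

Lemma frobeniusE m n (X : 'M[R]_(m, n)) : frobenius X = Num.sqrt (sqF X).
Proof. by []. Qed.

Lemma frobenius0 m n : frobenius (0 : 'M[R]_(m, n)) = 0.
Proof. by rewrite frobeniusE sqF0 sqrtr0. Qed.

Lemma frobeniusM_le m n p (X : 'M[R]_(m, n)) (Y : 'M[R]_(n, p)) :
  frobenius (X *m Y) <= frobenius X * frobenius Y.
Proof. by rewrite !frobeniusE -sqrtrM ?sqF_ge0// ler_wsqrtr// sqFM. Qed.

Lemma entry_le_frobenius m n (X : 'M[R]_(m, n)) i j : `|X i j| <= frobenius X.
Proof. by rewrite frobeniusE -sqrtr_sqr ler_wsqrtr// sqr_entry_le_sqF. Qed.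

Lemma norm_le_frobenius m n (X : 'M[R]_(m, n)) : `|X| <= frobenius X.
Proof.
change (mx_norm X <= frobenius X); rewrite mx_normrE; apply/bigmax_leP.
by split=> [|[i j] _]; [exact: sqrtr_ge0|exact: entry_le_frobenius].
Qed.

Lemma sqF_le_norm m n (X : 'M[R]_(m, n)) : sqF X <= (m * n)%:R * `|X| ^+ 2.
Proof.
rewrite sqFE (le_trans (ler_sum _ (fun i _ => ler_sum _
  (fun j _ => _ : _ <= `|X| ^+ 2))))//.
  move=> i _ j _; rewrite -real_normK ?num_real// ler_pXn2r ?nnegrE//.
  change (`|X i j| <= mx_norm X); rewrite mx_normrE.
  exact: (le_bigmax _ (fun ij => `|X ij.1 ij.2|) (i, j)).
by rewrite !sumr_const !card_ord -mulrnA mulr_natl mulnC.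
Qed.

(** Expand X in the basis of elementary matrices. Used both for an arbitrary norm and
    for the continuity of linear maps. *)
Lemma seminorm_le_frobenius m n (N : 'M[R]_(m, n) -> R) :
  (forall X Y, N (X + Y) <= N X + N Y) -> (forall a X, N (a *: X) = `|a| * N X) ->
  exists2 K, 0 <= K & forall X, N X <= K * frobenius X.
Proof.
move=> ND NZ; have N0 : N 0 = 0 by rewrite -(scale0r 0) NZ normr0 mul0r.
have Nge0 X : 0 <= N X.
  have := ND X (- X); rewrite subrr N0 -scaleN1r NZ normrN1 mul1r; lra.
have Nsum I (r : seq I) F : N (\sum_(i <- r) F i) <= \sum_(i <- r) N (F i).
  elim: r => [|i r IH]; first by rewrite !big_nil N0.
  by rewrite !big_cons (le_trans (ND _ _))// lerD2l.
exists (\sum_i \sum_j N (delta_mx i j)) => [|X]; first by do 2![apply: sumr_ge0 => ? _].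
rewrite {1}[X]matrix_sum_delta (le_trans (Nsum _ _ _))// mulr_suml ler_sum// => i _.
rewrite (le_trans (Nsum _ _ _))// mulr_suml ler_sum// => j _.
by rewrite NZ mulrC ler_wpM2l// entry_le_frobenius.
Qed.

Lemma op_norm_le m n (f : 'M[R]_(m, n) -> 'M[R]_(m, n)) K :
  0 <= K -> (forall Z, frobenius (f Z) <= frobenius Z * K) -> 0 <= op_norm f <= K.
Proof.
move=> K0 fK.
rewrite /op_norm; set A := [set _ | _ in _].
have ubA : ubound A K.
  by move=> _ [Z /= Z1 <-]; rewrite (le_trans (fK Z))// ler_piMl.
have A0 : A (frobenius (f 0)) by exists 0 => //=; rewrite frobenius0.
apply/andP; split; last by apply: ge_sup => //; exists (frobenius (f 0)).
apply: (@le_trans _ _ (frobenius (f 0))); first exact: sqrtr_ge0.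
by apply: ub_le_sup => //; exists K.
Qed.

Lemma is_diff_littleo (V W : normedModType R) (f : V -> W) (df : {linear V -> W}) x :
  continuous df ->
  (forall e : R, 0 < e -> \forall h \near (0 : V), `|f (h + x) - f x - df h| <= e *
    `|h|) ->
  is_diff x f df.
Proof.
move=> dfc small; have key : f \o shift x = cst (f x) + df +o_ 0 id.
  apply/eqaddoP => e e0; apply: filterS (small e e0) => h; apply: le_trans.
  by rewrite /= !fctE /= opprD addrA.
have dE : 'd f x = df :> (V -> W) by exact: diff_unique.
by apply: DiffDef => //; apply/diff_locallyP; rewrite dE.
Qed.

(** A quadratic error bound in the Frobenius norm identifies the derivative. *)
Lemma is_diff_quadratic m n p q (f df : 'M[R]_(m, n) -> 'M[R]_(p, q)) X0 C :
  linear df ->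
  (forall X, sqF (f X - f X0 - df (X - X0)) <= C * sqF (X - X0) ^+ 2) ->
  is_diff X0 f df.
Proof.
move=> dflin err.
pose dfM := GRing.isLinear.Build _ _ _ _ df dflin.
pose dfL : {linear 'M[R]_(m, n) -> 'M[R]_(p, q)} := HB.pack df dfM.
have [X Y|a X|K K0 dfK] := @seminorm_le_frobenius _ _ (fun X => `|dfL X|).
- by rewrite linearD ler_normD.
- by rewrite linearZ normrZ.
have dfc : continuous dfL.
  apply/bounded_linear_continuous/bounded_funP => r.
  exists (K * Num.sqrt ((m * n)%:R * r ^+ 2)) => X Xr; apply: le_trans (dfK X) _.
  rewrite ler_wpM2l// ler_wsqrtr// (le_trans (sqF_le_norm X))// ler_wpM2l//.
  by rewrite ler_pXn2r ?nnegrE// (le_trans _ Xr).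
apply: (is_diff_littleo dfc) => e e0.
pose c := Num.sqrt (`|C| * (m * n)%:R ^+ 2) + 1.
have c0 : 0 < c by rewrite ltr_wpDl ?sqrtr_ge0.
have : \forall h \near (0 : 'M[R]_(m, n)), `|h| <= e / c.
  by apply: nbhs0_le; rewrite divr_gt0.
apply: filterS => h hle; have := err (h + X0); rewrite addrK => errh.
rewrite (le_trans (norm_le_frobenius _))//.
apply: (@le_trans _ _ (c * `|h| * `|h|)); last first.
  by rewrite ler_wpM2r// mulrC -ler_pdivlMr.
rewrite frobeniusE -[leRHS]ger0_norm ?mulr_ge0 ?(ltW c0)// -sqrtr_sqr ler_wsqrtr//.
apply: (le_trans errh); apply: (@le_trans _ _ (`|C| * sqF h ^+ 2)).
  by rewrite ler_wpM2r ?sqr_ge0 ?ler_norm.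
apply: (@le_trans _ _ (`|C| * ((m * n)%:R * `|h| ^+ 2) ^+ 2)).
  by rewrite ler_wpM2l// ler_pXn2r ?nnegrE ?sqF_ge0 ?mulr_ge0 ?sqr_ge0// sqF_le_norm.
rewrite [leLHS](_ : _ = `|C| * (m * n)%:R ^+ 2 * (`|h| * `|h|) ^+ 2); last by ring.
rewrite -(mulrA c) [leRHS]exprMn ler_wpM2r ?sqr_ge0//.
rewrite -[leLHS]sqr_sqrtr ?mulr_ge0 ?sqr_ge0//.
by rewrite ler_pXn2r ?nnegrE ?sqrtr_ge0 ?(ltW c0)// /c lerDl.
Qed.

End NormComparison.

Section ProjectorDerivative.
Context {R : realType}.

(** Left and right dominant projectors of one and the same decomposition. The vectors
    selected by [left_vectors] and [right_vectors] may come from different ones. *)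
Lemma dominant_commute k m n (X : 'M[R]_(m, n)) U s V : is_svd X U s V ->
  X *m ((V *m pid_mx k : 'M[R]_(n, k)) *m (V *m pid_mx k : 'M[R]_(n, k))^T) =
  (U *m pid_mx k : 'M[R]_(m, k)) *m (U *m pid_mx k : 'M[R]_(m, k))^T *m X.
Proof.
move=> [UU VV _ _ ->]; rewrite !trmx_mul !tr_pid_mx !mulmxA.
rewrite -(mulmxA _ V^T V) VV mulmx1 -(mulmxA _ U^T U) UU mulmx1.
rewrite -(mulmxA _ (pid_mx k) (pid_mx k)) -(mulmxA U (pid_mx k) (pid_mx k)).
rewrite !mul_pid_mx !minnn; congr (_ *m _); rewrite -!mulmxA; congr (_ *m _).
rewrite -[RHS]trmxK trmx_mul tr_sv_mx tr_pid_mx; apply/matrixP => i j.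
rewrite mulmx_pidE [RHS]mxE mulmx_pidE !mxE eq_sym.
by case: eqP => [->|]; rewrite ?mul0r.
Qed.

(** The estimate is global in X, also where the projector is discontinuous in X. *)
Lemma rightproj_first_order k m n (X0 : 'M[R]_(m, n)) (G : 'M[R]_(n, m)) :
  let Q0 := 1%:M - G *m X0 in
  (1 <= k <= minn m n)%N -> \rank X0 = k ->
  orthoproj (G *m X0) -> orthoproj (X0 *m G) -> G *m X0 *m G = G ->
  rightproj k X0 = G *m X0 ->
  forall X : 'M[R]_(m, n),
  sqF (rightproj k X - rightproj k X0
       - (G *m (X - X0) *m Q0 + Q0 *m (X - X0)^T *m G^T))
    <= 304%:R * sqF G ^+ 2 * sqF (X - X0) ^+ 2.
Proof.
move=> Q0 kb X0k P0o P0o' GXG X0P X.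
have [U [s [V [svdX VE]]]] := @right_vectorsP _ k m n X.
have [/andP[_ km] /andP[_ kn]] : (1 <= k <= m)%N /\ (1 <= k <= n)%N.
  by move: kb; rewrite leq_min => /and3P[-> -> ->].
have [UU VV _ _ _] := svdX.
rewrite X0P; apply: projector_first_order P0o P0o' GXG _ _ _ _ _.
- exact: rightproj_orthoproj.
- exact: orthoproj_isometry (dominant_isometry km UU).
- by rewrite -X0P !rightproj_trace.
- by rewrite /rightproj VE; exact: dominant_commute svdX.
- by apply: rightproj_best; rewrite ?X0k.
Qed.

End ProjectorDerivative.

(** * Derivative of the iteration map *)

(** The derivative of the iteration at Xb, for C = B - Xb and G the pseudoinverse of
    Xb. It is defined over any commutative ring because its eigenvectors are complex. *)
Definition iteration_derivative (F : comNzRingType) m n (C : 'M[F]_(m, n))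
  (G : 'M[F]_(n, m))
  (E : 'M[F]_(m, n)) : 'M[F]_(m, n) := C *m E^T *m G^T + G^T *m G *m E *m C^T *m C.

Lemma iteration_derivative_linear (F : comNzRingType) m n (C : 'M[F]_(m, n))
  (G : 'M[F]_(n, m)) :
  linear (iteration_derivative C G).
Proof.
move=> a E E'; rewrite /iteration_derivative [(a *: E + E')^T]linearP/=.
by rewrite !(mulmxDr, mulmxDl, =^~ scalemxAr, =^~ scalemxAl, scalerDr) addrACA.
Qed.

Section IterationDerivative.
Context {R : realType}.

Section PseudoinverseAlgebra.
Variables (m n : nat) (B X : 'M[R]_(m, n)) (G : 'M[R]_(n, m)).
Hypotheses (XGT : (X *m G)^T = X *m G) (GXT : (G *m X)^T = G *m X).
Hypotheses (GXG : G *m X *m G = G) (XGX : X *m G *m X = X).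
Hypotheses (BG : B *m G = X *m G) (GB : G *m B = G *m X).
Let C := B - X.

Let CG : C *m G = 0. Proof. by rewrite mulmxBl BG subrr. Qed.
Let GC : G *m C = 0. Proof. by rewrite mulmxBr GB subrr. Qed.
Let GTX : G^T *m (G *m X) = G^T.
Proof. by rewrite -GXT -trmx_mul GXG. Qed.
Let XGTG : X *m G *m G^T = G^T.
Proof. by rewrite -XGT -trmx_mul mulmxA GXG. Qed.
Let GTQ : G^T *m (1%:M - G *m X) = 0.
Proof. by rewrite mulmxBr mulmx1 GTX subrr. Qed.
Let BQ : B *m (1%:M - G *m X) = C.
Proof. by rewrite mulmxBr mulmx1 mulmxA BG XGX. Qed.
Let QB : (1%:M - X *m G) *m B = C.
Proof. by rewrite mulmxBl mul1mx -mulmxA GB mulmxA XGX. Qed.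
Let QX : (1%:M - X *m G) *m X = 0.
Proof. by rewrite mulmxBl mul1mx XGX subrr. Qed.
Let QC : (1%:M - X *m G) *m C = C.
Proof. by rewrite mulmxBl mul1mx -mulmxA GC mulmx0 subr0. Qed.

(** The chain rule for [S1_is_diff] and [S2_is_diff]. Most terms vanish because C and G
    annihilate each other and the complementary projectors kill G^T and X. *)
Lemma iteration_derivative_comp E :
  let F := B *m (G *m E *m (1%:M - G *m X) + (1%:M - G *m X) *m E^T *m G^T) in
  (G^T *m F^T *m (1%:M - X *m G) + (1%:M - X *m G) *m F *m G) *m B
  = iteration_derivative C G E.
Proof.
move=> F; have FE : F = X *m (G *m E *m (1%:M - G *m X)) + C *m E^T *m G^T.
  by rewrite /F mulmxDr !mulmxA BG BQ.
have FTE : F^T = (1%:M - G *m X) *m (E^T *m G^T *m X^T) + G *m E *m C^T.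
  rewrite FE [(_ + _)^T]linearD/= !trmx_mul !trmxK [(1%:M - _)^T]linearB/= trmx1 GXT.
  by rewrite !mulmxA.
rewrite mulmxDl addrC; congr (_ + _).
  by rewrite FE mulmxDr !mulmxA QX !mul0mx add0r QC -!mulmxA GB GTX.
by rewrite FTE -mulmxA QB [G^T *m (_ + _)]mulmxDr !mulmxA GTQ !mul0mx add0r.
Qed.

(** The derivative factors through the tangent space: C and G annihilate each other,
    which removes exactly the part of E orthogonal to that space. *)
Lemma iteration_derivative_tangent E :
  iteration_derivative C G (E *m (G *m X) + X *m G *m E - X *m G *m (E *m (G *m X)))
  = iteration_derivative C G E.
Proof.
have CGX : C *m (G *m X) = 0 by rewrite mulmxA CG mul0mx.
have [e1 e2] : C *m (E *m (G *m X) + X *m G *m E - X *m G *m (E *m (G *m X)))^T *m G^T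
  = C *m E^T *m G^T
  /\ G *m (E *m (G *m X) + X *m G *m E - X *m G *m (E *m (G *m X))) *m C^T = G *m E *m
    C^T.
  split.
    rewrite [(_ - _)^T]linearB/= [(_ + _)^T]linearD/= !trmx_mul -[X^T *m G^T]trmx_mul
      GXT -[G^T *m X^T]trmx_mul XGT.
    rewrite mulmxBr mulmxDr !mulmxA -(mulmxA C G X) CGX !mul0mx add0r subr0.
    by rewrite -!mulmxA [X *m (G *m G^T)]mulmxA XGTG.
  by rewrite [G *m _]mulmxBr mulmxDr !mulmxA GXG addrAC subrr add0r.
rewrite /iteration_derivative e1; congr (_ + _ *m _).
by rewrite -!(mulmxA G^T) e2.
Qed.
End PseudoinverseAlgebra.

Variables (k m n : nat) (B Xb : 'M[R]_(m, n)) (s : nat -> R) (U : 'M[R]_m) (V : 'M[R]_n)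
   (U1 : 'M[R]_(m, k)) (V1 : 'M[R]_(n, k)) (D Di : 'M[R]_k).
Hypothesis T : truncated_svd B Xb s U V U1 V1 D Di.
Let G := pinv U1 V1 Di.
Let kb := tsvd_bounds T.

Let GXG : G *m Xb *m G = G.
Proof. by rewrite (pinvX T) (mulP_pinv T). Qed.

Let GXo : orthoproj (G *m Xb).
Proof. by rewrite (pinvX T); apply: orthoproj_isometry; exact: tsvd_VV T. Qed.

Let XGo : orthoproj (Xb *m G).
Proof. by rewrite (Xpinv T); apply: orthoproj_isometry; exact: tsvd_UU T. Qed.

Let BG : B *m G = Xb *m G. Proof. by rewrite (Bpinv T) (Xpinv T). Qed.
Let GB : G *m B = G *m Xb. Proof. by rewrite (pinvB T) (pinvX T). Qed.

Let XGX : Xb *m G *m Xb = Xb.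
Proof. by rewrite -BG -mulmxA (pinvX T) (tsvd_BP T). Qed.

Lemma S1_is_diff : is_diff Xb (S1 k B)
  (fun E => B *m (G *m E *m (1%:M - G *m Xb) + (1%:M - G *m Xb) *m E^T *m G^T)).
Proof.
apply: (is_diff_quadratic (C := sqF B * (304%:R * sqF G ^+ 2))).
  move=> a E F; rewrite [(a *: E + F)^T]linearP/=; move: (1%:M - _) => Q.
  by rewrite !(mulmxDr, mulmxDl, =^~ scalemxAr, =^~ scalemxAl, scalerDr) addrACA.
move=> X; rewrite /S1 !P1E -!mulmxBr -mulrA; apply: sqFM_le => //.
apply: rightproj_first_order => //; first exact: tsvd_rank T.
by rewrite (rightprojX T) (pinvX T).
Qed.

Lemma S2_is_diff : is_diff Xb (S2 k B)
  (fun E => (G^T *m E^T *m (1%:M - Xb *m G) + (1%:M - Xb *m G) *m E *m G) *m B).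
Proof.
apply: (is_diff_quadratic (C := 304%:R * sqF G ^+ 2 * sqF B)).
  move=> a E F; rewrite [(a *: E + F)^T]linearP/=; move: (1%:M - _) => Q.
  by rewrite !(mulmxDr, mulmxDl, =^~ scalemxAr, =^~ scalemxAl, scalerDr) addrACA.
move=> X; rewrite /S2 !P2E !leftprojE -!mulmxBl mulrAC; apply: sqFM_le => //.
have : sqF (rightproj k X^T - rightproj k Xb^T
     - (G^T *m (X^T - Xb^T) *m (1%:M - G^T *m Xb^T)
       + (1%:M - G^T *m Xb^T) *m (X^T - Xb^T)^T *m G^T^T))
    <= 304%:R * sqF G^T ^+ 2 * sqF (X^T - Xb^T) ^+ 2.
  apply: rightproj_first_order; rewrite -?trmx_mul ?(proj1 GXo) ?(proj1 XGo) //.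
  - by rewrite minnC.
  - by rewrite mxrank_tr (tsvd_rank T).
  - by rewrite mulmxA GXG.
  - by rewrite -leftprojE (leftprojX T) (Xpinv T).
by rewrite -trmx_mul (proj1 XGo) -[X^T - Xb^T]linearB/= !sqF_tr !trmxK.
Qed.

Lemma S1Xb : S1 k B Xb = Xb.
Proof. by rewrite /S1 P1E (rightprojX T) (tsvd_BP T). Qed.

Lemma Smap_is_diff : is_diff Xb (Smap k B) (iteration_derivative (B - Xb) G).
Proof.
have d1 := S1_is_diff.
pose dS2 E := (G^T *m E^T *m (1%:M - Xb *m G) + (1%:M - Xb *m G) *m E *m G) *m B.
have S2d Y : Y = Xb -> is_diff Y (S2 k B) dS2 by move=> ->; exact: S2_is_diff.
have d2 := S2d _ S1Xb.
apply: (is_diff_eq (is_diff_comp d1 d2)).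
apply/funext => E; have [GXT _] := GXo; exact: iteration_derivative_comp.
Qed.

Lemma Smap_tangent E :
  iteration_derivative (B - Xb) G (Ptan k Xb E) = iteration_derivative (B - Xb) G E.
Proof.
rewrite /Ptan !P1E !P2E (rightprojX T) (leftprojX T) -(pinvX T) -(Xpinv T).
rewrite -/G -[_ *m E *m _]mulmxA.
have [GXT _] := GXo; have [XGT _] := XGo; exact: iteration_derivative_tangent.
Qed.

End IterationDerivative.

(** * Spectral radius of the derivative *)

Section Spectrum.
Context {R : realType}.
Local Notation c := (real_complex R).

(** The complexification of a real linear map has the complexified matrix. *)
Lemma map_lin_mx m n p q (f : 'M[R]_(m, n) -> 'M[R]_(p, q))
    (g : 'M[R[i]]_(m, n) -> 'M[R[i]]_(p, q)) :
  (forall X, map_mx c (f X) = g (map_mx c X)) -> map_mx c (lin_mx f) = lin_mx g.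
Proof.
move=> fg; apply/matrixP => i j; rewrite !mxE /=.
rewrite -[in RHS](map_delta_mx c) -map_vec_mx -fg -map_mxvec.
by rewrite [RHS]mxE.
Qed.

Lemma normc_real (x : R) : ComplexField.Normc.normc (c x) = `|x|.
Proof. by rewrite /= expr0n addr0 sqrtr_sqr. Qed.

Lemma map_iteration_derivative m n (C : 'M[R]_(m, n)) G E :
  map_mx c (iteration_derivative C G E) = iteration_derivative (map_mx c C)
    (map_mx c G) (map_mx c E).
Proof. by rewrite /iteration_derivative map_mxD !map_mxM !map_trmx. Qed.

Lemma eigenvalue_iteration_derivativeP m n (C : 'M[R]_(m, n)) G z :
  reflect (exists2 E : 'M[R[i]]_(m, n), iteration_derivative (map_mx c C) (map_mx c G)
    E = z *: E & E != 0)
    (eigenvalue (map_mx c (lin_mx (iteration_derivative C G))) z).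
Proof.
pose g := iteration_derivative (map_mx c C) (map_mx c G).
pose gM := GRing.isLinear.Build _ _ _ _ g (@iteration_derivative_linear _ _ _ _ _).
pose gL : {linear 'M[R[i]]_(m, n) -> 'M[R[i]]_(m, n)} := HB.pack g gM.
rewrite (map_lin_mx (g := gL)); last by move=> X; exact: map_iteration_derivative.
apply: (iffP eigenvalueP) => [[v vE v0]|[E EE E0]].
  exists (vec_mx v); last by rewrite vec_mx_eq0.
  by rewrite -[LHS]/(gL (vec_mx v)) -[LHS]mxvecK -mul_vec_lin vec_mxK vE linearZ.
exists (mxvec E); last by rewrite mxvec_eq0.
by rewrite mul_vec_lin -linearZ/= -EE.
Qed.

Variables (k m n : nat) (B Xb : 'M[R]_(m, n)) (s : nat -> R) (U : 'M[R]_m) (V : 'M[R]_n)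
   (U1 : 'M[R]_(m, k)) (V1 : 'M[R]_(n, k)) (D Di : 'M[R]_k).
Hypothesis T : truncated_svd B Xb s U V U1 V1 D Di.
Let G := pinv U1 V1 Di.
Let C := B - Xb.
Let rate := (s k.+1 / s k) ^+ 2.
Let s2 i := if (i <= k)%N then 0 else s i.

Lemma U1_pinv : U1^T *m (G^T *m G) = Di *m Di *m U1^T.
Proof.
rewrite /G /pinv !trmx_mul trmxK (tsvd_DiT T) !mulmxA (tsvd_UU T) mul1mx.
by rewrite -(mulmxA _ V1^T V1) (tsvd_VV T) mulmx1.
Qed.

Lemma gram_rest_V : C^T *m C *m V = V *m diag_mx (\row_j s2 j.+1 ^+ 2).
Proof.
by rewrite (gram_rest T) -mulmxA; have [_ -> _ _ _] := tsvd_svd T; rewrite mulmx1.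
Qed.

Lemma rate_bound i j : (i < k)%N -> (s2 j.+1 / s i.+1) ^+ 2 <= rate.
Proof.
move=> ik; have [_ _ [s0 smon] sz _] := tsvd_svd T; have sk := tsvd_sk_gt0 T.
have sik : s k <= s i.+1 by apply: smon.
have si : 0 < s i.+1 by exact: lt_le_trans sik.
rewrite ler_pXn2r ?nnegrE ?divr_ge0// ?(ltW si)//; last by rewrite /s2; case: ifP.
rewrite ler_pM ?invr_ge0// ?lef_pV2 ?posrE//; rewrite /s2; case: ltnP => // kj.
exact: smon.
Qed.

(** In singular coordinates W = U1^T E V, the first k rows of the eigenvalue equation
    read z * W i j = (s j.+1 / s i.+1) ^ 2 * W i j when j >= k, and z * W i j = 0 when
    j < k. If W = 0 then G *m E = 0, and the derivative annihilates E. *)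
Lemma eigenvalue_bound z :
  eigenvalue (map_mx c (lin_mx (iteration_derivative C G))) z ->
  ComplexField.Normc.normc z <= rate.
Proof.
move=> /eigenvalue_iteration_derivativeP[E]; set Cc := map_mx c C;
  set Gc := map_mx c G => EE E0.
pose u := map_mx c U1^T; pose v := map_mx c V.
pose d := map_mx c (diag_mx (\row_(j < n) s2 j.+1 ^+ 2)).
have uC : u *m Cc = 0 by rewrite -map_mxM (U1_rest T) map_mx0.
have uGG : u *m (Gc^T *m Gc) = map_mx c (Di *m Di) *m u.
  by rewrite map_trmx -!map_mxM U1_pinv.
have CCv : Cc^T *m Cc *m v = v *m d by rewrite map_trmx -!map_mxM gram_rest_V.
have GU : Gc = Gc *m map_mx c U1 *m u.
  by rewrite -!map_mxM -mulmxA (pinv_mulP T).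
have vv : v *m map_mx c V^T = 1%:M.
  by rewrite -map_mxM; have [_ /mulmx1C-> _ _ _] := tsvd_svd T; rewrite map_mx1.
pose W := u *m E *m v.
have WE : z *: W = map_mx c (Di *m Di) *m W *m d.
  rewrite /W [z *: _]scalemxAl [z *: (u *m E)]scalemxAr -EE mulmxDr mulmxDl.
  rewrite !mulmxA uC !mul0mx add0r -(mulmxA _ Cc^T Cc) -(mulmxA _ (Cc^T *m Cc) v) CCv.
  by rewrite -(mulmxA u Gc^T Gc) uGG !mulmxA.
have WEij i j : z * W i j = c ((s2 j.+1 / s i.+1) ^+ 2) * W i j.
  have := congr1 (fun A : 'M[R[i]]_(_, _) => A i j) WE; rewrite mxE => ->.
  rewrite (tsvd_Di T) mulmx_diag map_diag_mx /d map_diag_mx mul_mx_diag mxE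
    mul_diag_mx mxE.
  rewrite 6!mxE mulrAC -rmorphM; congr (c _ * _).
  by rewrite exprMn [(s i.+1)^-1 ^+ 2]expr2 mulrC.
have [z0|z0] := eqVneq z 0.
  by rewrite z0 -[0]/(c 0) normc_real normr0 sqr_ge0.
have [W0|/matrix0Pn[i [j Wij]]] := eqVneq W 0.
  have GE : Gc *m E = 0.
    have uE0 : u *m E = 0 by rewrite -[LHS]mulmx1 -vv mulmxA -/W W0 mul0mx.
    by rewrite GU -(mulmxA _ u E) uE0 mulmx0.
  case/eqP: E0; apply: (scalerI z0); rewrite -EE scaler0 /iteration_derivative.
  by rewrite -!mulmxA (mulmxA Gc) GE mul0mx !mulmx0 addr0 -trmx_mul GE trmx0 mulmx0.
have -> : z = c ((s2 j.+1 / s i.+1) ^+ 2) by exact: (mulIf Wij).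
by rewrite normc_real ger0_norm ?sqr_ge0// rate_bound.
Qed.

(** For s k.+1 = 0 the matrix Xb itself is in the kernel. Otherwise let u and v be
    the k-th left and the (k+1)-th right singular vectors: the derivative maps u^T v^T
    to F + rate *: (u^T v^T) and annihilates F, so this image is an eigenvector. *)
Lemma rate_eigenvalue :
  eigenvalue (map_mx c (lin_mx (iteration_derivative C G))) (c rate).
Proof.
suff [E EE E0] : exists2 E : 'M[R]_(m, n), iteration_derivative C G E = rate *: E & E
  != 0.
  apply/eigenvalue_iteration_derivativeP; exists (map_mx c E);
    last by rewrite map_mx_eq0.
  by rewrite -map_iteration_derivative EE map_mxZ.
have [UU VV [s0 smon] sz _] := tsvd_svd T; have sk := tsvd_sk_gt0 T.
have CG : C *m G = 0 by rewrite mulmxBl (Bpinv T) (Xpinv T) subrr.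
have [s10|s1N0] := eqVneq (s k.+1) 0.
  exists Xb; last first.
    by rewrite -mxrank_eq0 (tsvd_rank T) -lt0n; have /andP[] := tsvd_bounds T.
  have CX : C *m Xb^T = 0.
    by rewrite (tsvd_X T) !trmx_mul trmxK (mulmxA C V1) (rest_V1 T) mul0mx.
  rewrite /rate s10 mul0r expr0n/= scale0r /iteration_derivative CX mul0mx add0r.
  have XC : Xb *m C^T = 0 by rewrite -[LHS]trmxK trmx_mul trmxK CX trmx0.
  by rewrite -(mulmxA _ Xb) XC mulmx0 mul0mx.
have kmn : (k < minn m n)%N.
  by rewrite ltnNge; apply: contra s1N0 => ?; rewrite sz.
have kn : (k < n)%N by rewrite (leq_trans kmn) ?geq_minr.
have k0 : (0 < k)%N by have /andP[] := tsvd_bounds T.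
have k1k : (k.-1 < k)%N by rewrite prednK.
pose e : 'rV[R]_k := delta_mx 0 (Ordinal k1k).
pose u := e *m U1^T; pose f : 'cV[R]_n := delta_mx (Ordinal kn) 0; pose v := V *m f.
have ee : e *m e^T = 1%:M.
  by rewrite trmx_delta mul_delta_mx; apply/matrixP => i j; rewrite !ord1 !mxE.
have eDi : e *m Di = (s k)^-1 *: e.
  rewrite (tsvd_Di T); apply/rowP => j; rewrite mul_mx_diag !mxE eqxx /= mulrC.
  by case: eqP => [->|_]; rewrite /= ?mulr0// prednK.
have uC : u *m C = 0 by rewrite -mulmxA (U1_rest T) mulmx0.
have uGG : u *m (G^T *m G) = (s k)^-1 ^+ 2 *: u.
  by rewrite -mulmxA U1_pinv !mulmxA eDi -!scalemxAl eDi -!scalemxAl scalerA.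
have CCv : C^T *m C *m v = s k.+1 ^+ 2 *: v.
  rewrite /v mulmxA gram_rest_V -mulmxA scalemxAr; congr (_ *m _).
  apply/colP => j; rewrite mul_diag_mx !mxE andbT.
  by case: eqP => [->|_]; rewrite ?mulr0// /s2 /= ltnn.
have uu : u *m u^T = 1%:M.
  by rewrite trmx_mul trmxK mulmxA -(mulmxA e) (tsvd_UU T) mulmx1.
have vv : v^T *m v = 1%:M.
  rewrite trmx_mul mulmxA -(mulmxA _ V^T) VV mulmx1 trmx_delta mul_delta_mx.
  by apply/matrixP => i j; rewrite !ord1 !mxE.
clearbody u v; pose F := C *m (v *m u) *m G^T.
have ME : iteration_derivative C G (u^T *m v^T) = F + rate *: (u^T *m v^T).
  rewrite /iteration_derivative trmx_mul !trmxK; congr (_ + _).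
  have -> : rate *: (u^T *m v^T) = ((s k)^-1 ^+ 2 *: u)^T *m (s k.+1 ^+ 2 *: v)^T.
    by rewrite [(_ *: u)^T]linearZ [(_ *: v)^T]linearZ/= -scalemxAl -scalemxAr scalerA
      /rate mulrC -exprMn.
  by rewrite -uGG -CCv !trmx_mul !trmxK !mulmxA.
have MF : iteration_derivative C G F = 0.
  have GF : G *m F = 0 by rewrite /F !mulmxA (mulmxBr G) (pinvB T) (pinvX T) subrr
    !mul0mx.
  have CFT : C *m F^T = 0 by rewrite /F trmx_mul trmxK (mulmxA C G) CG mul0mx.
  by rewrite /iteration_derivative CFT -(mulmxA _ G F) GF !(mul0mx, mulmx0) addr0.
exists (F + rate *: (u^T *m v^T)).
  by rewrite -[in RHS]ME [F + _]addrC iteration_derivative_linear MF addr0.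
apply/eqP => /(congr1 (fun A => u *m A *m v)).
rewrite mulmxDr /F !mulmxA uC !mul0mx add0r mulmx0 mul0mx -scalemxAr.
rewrite !mulmxA uu mul1mx -scalemxAl vv => /matrixP/(_ 0 0)/eqP.
rewrite !mxE mulr1 sqrf_eq0 mulf_eq0 invr_eq0 (negPf s1N0) gt_eqF//.
Qed.

Lemma spectral_radius_iteration_derivative :
  spectral_radius (iteration_derivative C G) = rate.
Proof.
rewrite /spectral_radius; set A := [set _ | _ in _].
have ratein : A rate.
  exists (c rate); first exact: rate_eigenvalue.
  by rewrite normc_real ger0_norm// sqr_ge0.
have ub : ubound A rate by move=> _ [z /eigenvalue_bound zle <-].
apply/le_anti/andP; split; first by apply: ge_sup => //; exists rate.
by apply: ub_le_sup => //; exists rate.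
Qed.

Theorem spectral_radius_Smap :
  differentiable (Smap k B) Xb /\
  spectral_radius ('d (Smap k B) Xb \o Ptan k Xb) = rate.
Proof.
have [dS dSE] := Smap_is_diff T; split=> //.
rewrite -spectral_radius_iteration_derivative; congr spectral_radius.
by apply/funext => E; rewrite /= dSE (Smap_tangent T).
Qed.
End Spectrum.

(** * Root-linear convergence *)

Section Limsup.
Context {R : realType}.

Lemma eventually_geometric_le (K q e : R) : 0 <= q -> q < 1 -> 0 < e ->
  \forall l \near \oo, K * q ^+ l <= e.
Proof.
move=> q0 q1 e0; have qn : `|q| < 1 by rewrite ger0_norm.
have /cvgrPdist_le/(_ e e0) := cvg_geometric K qn.
apply: filterS => l; rewrite sub0r normrN; apply: le_trans.
exact: ler_norm.
Qed.

(** For e > 0, K * q ^ l <= (q + e) ^ l as soon as l is large, because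
    (q / (q + e)) ^ l tends to 0. *)
Lemma limsup_root_le (u : nat -> R) (K q : R) : 0 <= q ->
  (forall l, 0 <= u l) -> (forall l, u l <= K * q ^+ l) ->
  (limsup_root u <= q%:E)%E.
Proof.
move=> q0 u0 uK; apply/lee_addgt0Pr => e e0; rewrite -EFinD.
have qe : 0 < q + e by rewrite ltr_wpDl.
have /(eventually_geometric_le K) : 0 <= q / (q + e) by rewrite divr_ge0// ltW.
move=> /(_ 1 _ ltr01); rewrite ltr_pdivrMr// mul1r ltrDl => /(_ e0)[N _ small].
(* [N.+1] rather than [N] excludes l = 0, where the exponent is 0. *)
apply: (@le_trans _ _ (ereal_sup ((fun l => (u l `^ l%:R^-1)%:E) @`
  [set l | (N.+1 <= l)%N]))).
  apply: ereal_inf_lbound; exists [set l | (N.+1 <= l)%N] => //.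
  by exists N.+1.
apply: ge_ereal_sup => _ [l /= Nl <-]; rewrite lee_fin.
have l0 : (l%:R : R) != 0 by rewrite pnatr_eq0 -lt0n (leq_ltn_trans _ Nl).
have ule : u l <= (q + e) ^+ l.
  apply: le_trans (uK l) _; have := small l (ltnW Nl).
  by rewrite expr_div_n mulrA ler_pdivrMr ?exprn_gt0// mul1r.
have -> : q + e = ((q + e) ^+ l) `^ l%:R^-1.
  by rewrite -powR_mulrn ?(ltW qe)// -powRrM divff// powRr1 ?(ltW qe).
by rewrite ge0_ler_powR ?nnegrE ?invr_ge0 ?exprn_ge0 ?(ltW qe).
Qed.

Lemma frobenius_geometric m n (X : nat -> 'M[R]_(m, n)) a q : 0 <= a -> 0 <= q ->
  (forall l, sqF (X l.+1) <= a * (q ^+ l.+1) ^+ 2) ->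
  exists2 K, 0 <= K & forall l, frobenius (X l) <= K * q ^+ l.
Proof.
move=> a0 q0 Xle; exists (frobenius (X 0%N) + Num.sqrt a);
  first by rewrite addr_ge0 ?sqrtr_ge0.
case=> [|l]; first by rewrite expr0 mulr1 lerDl sqrtr_ge0.
apply: (@le_trans _ _ (Num.sqrt a * q ^+ l.+1)); last first.
  by rewrite ler_wpM2r ?exprn_ge0// lerDr sqrtr_ge0.
rewrite frobeniusE -[q ^+ l.+1]ger0_norm ?exprn_ge0// -sqrtr_sqr -sqrtrM//.
exact: ler_wsqrtr.
Qed.

End Limsup.

(** * The iteration in graph coordinates *)

Section GraphIteration.
Context {R : realType}.

Lemma graph_row_free k n (V1 : 'M[R]_(n, k)) (Z : 'M[R]_(k, n)) :
  V1^T *m V1 = 1%:M -> Z *m V1 = 0 -> row_free (V1^T + Z).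
Proof. by move=> VV ZV; apply/row_freeP; exists V1; rewrite mulmxDl VV ZV addr0. Qed.

(** Since 1%:M - P annihilates V1 + Z^T, it maps V1 to minus its value on Z^T. Together
    with [orthoproj_swap] this bounds the distance of the projectors by Z, without any
    estimate on Gram matrices. *)
Lemma graph_projector n k (V1 : 'M[R]_(n, k)) Z (P : 'M[R]_n) :
  V1^T *m V1 = 1%:M -> orthoproj P -> \tr P = k%:R ->
  (V1^T + Z) *m P = V1^T + Z -> sqF (P - V1 *m V1^T) <= 4 * sqF Z.
Proof.
move=> VV Po trP WP; have [PT PP] := Po; have Qo := orthoprojC Po.
have P0o := orthoproj_isometry VV.
have trP0 : \tr (V1 *m V1^T) = k%:R by rewrite mxtrace_mulC VV mxtrace1.
have QP0 : sqF ((1%:M - P) *m (V1 *m V1^T)) <= sqF Z.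
  rewrite mulmxA sqF_isometryr ?trmxK//.
  have -> : (1%:M - P) *m V1 = - ((1%:M - P) *m Z^T).
    apply/eqP; rewrite -addr_eq0 -mulmxDr; apply/eqP.
    have := congr1 trmx WP; rewrite trmx_mul PT linearD/= trmxK => <-.
    by rewrite mulmxA mulmxBl mul1mx PP subrr mul0mx.
  by rewrite sqFN (le_trans (sqF_orthoprojl_le _ Qo))// sqF_tr.
have PQ0 : sqF (P *m (1%:M - V1 *m V1^T)) <= sqF Z.
  by rewrite orthoproj_swap ?trP.
have -> : P - V1 *m V1^T = P *m (1%:M - V1 *m V1^T) + - ((1%:M - P) *m (V1 *m V1^T)).
  by rewrite mulmxBr mulmx1 mulmxBl mul1mx; entrywise_ring.
apply: le_trans (sqFD _ _) _; rewrite sqFN; lra.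
Qed.

(** A row space of dimension k that meets the left kernel of V1 only in 0 has a unique
    basis V1^T + Z with Z *m V1 = 0. Multiplying it by B^T and normalizing by Di gives
    the basis U1^T + half_graph B Di Z of the column space after the half-step. *)
Definition half_graph k m n (B : 'M[R]_(m, n)) (Di : 'M[R]_k) (Z : 'M[R]_(k, n)) :
  'M[R]_(k, m) :=
  Di *m Z *m B^T.

(** Z *m V1 = 0 lets only the remainder B - Xb act on Z, with norm s k.+1, while Di
    contributes 1 / s k. *)
Lemma half_step k m n (B Xb : 'M[R]_(m, n)) s U V U1 V1 (D Di : 'M[R]_k)
  (T : truncated_svd B Xb s U V U1 V1 D Di) (X : 'M[R]_(m, n)) (Z : 'M[R]_(k, n)) :
  Z *m V1 = 0 -> \rank X = k -> ((V1^T + Z)%R :=: X)%MS ->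
  let Y := half_graph B Di Z in
  [/\ Y *m U1 = 0, \rank (S1 k B X) = k, ((U1^T + Y)%R :=: (S1 k B X)^T)%MS &
      sqF Y <= (s k.+1 / s k) ^+ 2 * sqF Z].
Proof.
move=> ZV Xk WX Y; have kb := tsvd_bounds T; have [UU VV] := (tsvd_UU T, tsvd_VV T).
have YU : Y *m U1 = 0.
  by rewrite /Y /half_graph -mulmxA (tsvd_BU T) -mulmxA (mulmxA Z) ZV mul0mx mulmx0.
have DUY : (V1^T + Z) *m B^T = D *m (U1^T + Y).
  rewrite mulmxDl mulmxDr /Y /half_graph !mulmxA (tsvd_DDi T) mul1mx; congr (_ + _).
  by rewrite -trmx_mul (tsvd_BV T) trmx_mul (tsvd_DT T).
have Pe : rightproj k X = rowproj (V1^T + Z).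
  exact: (rightproj_rowproj kb (graph_row_free VV ZV) WX).
have [_ _ PW _] := rowprojP (graph_row_free VV ZV).
have S1T : (S1 k B X)^T = rightproj k X *m B^T.
  by rewrite /S1 P1E trmx_mul (proj1 (rightproj_orthoproj kb X)).
have e : ((U1^T + Y)%R :=: (S1 k B X)^T)%MS.
  rewrite S1T Pe; apply: eqmx_trans (eqmxMr _ (eqmx_sym PW)).
  rewrite DUY; apply/eqmx_sym/eqmxMfull.
  by rewrite row_full_unit; case/mulmx1_unit: (tsvd_DDi T).
split=> //.
  by rewrite -mxrank_tr -e; exact/eqP/(graph_row_free UU YU).
have -> : Y = Di *m (Z *m (B - Xb)^T).
  have ZX : Z *m Xb^T = 0 by rewrite (tsvd_X T) !trmx_mul trmxK (mulmxA Z) ZV mul0mx.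
  by rewrite /Y /half_graph -mulmxA [(B - Xb)^T]linearB/= mulmxBr ZX subr0.
apply: le_trans (sqF_mul_Di T _) _.
rewrite [leRHS](_ : _ = (s k)^-1 ^+ 2 * (s k.+1 ^+ 2 * sqF Z)); last by ring.
by rewrite ler_wpM2l ?sqr_ge0// (sqF_mul_rest T).
Qed.

Section RowSpaceGraph.
Variables (k m n : nat) (B Xb : 'M[R]_(m, n)) (s : nat -> R) (U : 'M[R]_m) (V : 'M[R]_n)
   (U1 : 'M[R]_(m, k)) (V1 : 'M[R]_(n, k)) (D Di : 'M[R]_k).
Hypothesis T : truncated_svd B Xb s U V U1 V1 D Di.
Let kb := tsvd_bounds T.
Let VV := tsvd_VV T.
Let rate := (s k.+1 / s k) ^+ 2.

(** The second half-step is the first one for the transposed problem. *)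
Lemma Smap_S1_tr (X : 'M[R]_(m, n)) : Smap k B X = (S1 k B^T (S1 k B X)^T)^T.
Proof.
have kbT : (1 <= k <= minn n m)%N by rewrite minnC.
rewrite /Smap /= /S2 P2E leftprojE [S1 k B^T _]P1E [RHS]trmx_mul trmxK.
by rewrite (proj1 (rightproj_orthoproj kbT _)).
Qed.

Lemma full_step (X : 'M[R]_(m, n)) (Z : 'M[R]_(k, n)) :
  Z *m V1 = 0 -> \rank X = k -> ((V1^T + Z)%R :=: X)%MS ->
  exists Z' : 'M[R]_(k, n), [/\ Z' *m V1 = 0, \rank (Smap k B X) = k,
    ((V1^T + Z')%R :=: Smap k B X)%MS & sqF Z' <= rate ^+ 2 * sqF Z].
Proof.
move=> ZV Xk WX; have [YU rk e Yle] := half_step T ZV Xk WX.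
have rkT : \rank (S1 k B X)^T = k by rewrite mxrank_tr.
have [Z'V rk' e' Z'le] := half_step (truncated_svd_tr T) YU rkT e.
eexists; rewrite Smap_S1_tr; split; [exact: Z'V|by rewrite mxrank_tr| |].
  by rewrite -[V1]trmxK in e' *.
apply: le_trans Z'le _; by rewrite [rate ^+ 2]expr2 -mulrA ler_wpM2l ?sqr_ge0.
Qed.

Lemma graph_iterates (X0 : 'M[R]_(m, n)) (Z0 : 'M[R]_(k, n)) l :
  Z0 *m V1 = 0 -> \rank X0 = k -> ((V1^T + Z0)%R :=: X0)%MS ->
  exists Z : 'M[R]_(k, n), [/\ Z *m V1 = 0, \rank (iter l (Smap k B) X0) = k,
    ((V1^T + Z)%R :=: iter l (Smap k B) X0)%MS & sqF Z <= (rate ^+ l) ^+ 2 * sqF Z0].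
Proof.
move=> Z0V X0k W0; elim: l => [|l [Z [ZV Xk WX Zle]]].
  by exists Z0; split=> //; rewrite !expr1n mul1r.
have [Z' [Z'V Xk' WX' Z'le]] := full_step ZV Xk WX.
exists Z'; split=> //; apply: (le_trans Z'le).
rewrite [leRHS](_ : _ = rate ^+ 2 * ((rate ^+ l) ^+ 2 * sqF Z0)).
  by rewrite ler_wpM2l ?sqr_ge0.
by rewrite (exprS rate l); move: (rate ^+ l) => r; ring.
Qed.

Lemma rightproj_graph (X : 'M[R]_(m, n)) (Z : 'M[R]_(k, n)) :
  Z *m V1 = 0 -> ((V1^T + Z)%R :=: X)%MS ->
  sqF (rightproj k X - rightproj k Xb) <= 4 * sqF Z.
Proof.
move=> ZV WX; rewrite (rightprojX T); apply: graph_projector => //.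
- exact: rightproj_orthoproj.
- exact: rightproj_trace.
rewrite (rightproj_rowproj kb (graph_row_free VV ZV) WX).
by have [] := rowprojP (graph_row_free VV ZV).
Qed.

End RowSpaceGraph.

Section ErrorBounds.
Variables (k m n : nat) (B Xb : 'M[R]_(m, n)) (s : nat -> R) (U : 'M[R]_m) (V : 'M[R]_n)
   (U1 : 'M[R]_(m, k)) (V1 : 'M[R]_(n, k)) (D Di : 'M[R]_k).
Hypothesis T : truncated_svd B Xb s U V U1 V1 D Di.
Let kb := tsvd_bounds T.
Let VV := tsvd_VV T.
Let rate := (s k.+1 / s k) ^+ 2.

Lemma leftproj_half (X : 'M[R]_(m, n)) (Z : 'M[R]_(k, n)) :
  Z *m V1 = 0 -> \rank X = k -> ((V1^T + Z)%R :=: X)%MS ->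
  sqF (leftproj k (S1 k B X) - leftproj k Xb) <= 4 * (rate * sqF Z).
Proof.
move=> ZV Xk WX; have [YU rk e Yle] := half_step T ZV Xk WX.
rewrite !leftprojE; apply: le_trans (rightproj_graph (truncated_svd_tr T) YU e) _.
by rewrite ler_wpM2l.
Qed.

(** The columns of Smap k B X lie in the column space of S1 k B X, and the ranks agree. *)
Lemma leftproj_Smap (X : 'M[R]_(m, n)) :
  \rank (S1 k B X) = k -> \rank (Smap k B X) = k ->
  leftproj k (Smap k B X) = leftproj k (S1 k B X).
Proof.
move=> rk rk'; have kbT : (1 <= k <= minn n m)%N by rewrite minnC.
have rkT : \rank (S1 k B X)^T = k by rewrite mxrank_tr.
rewrite [LHS]leftprojE; apply: (rightproj_unique kbT).
- by rewrite mxrank_tr.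
- by rewrite leftprojE; exact: rightproj_orthoproj.
apply/eqmx_sym/eqmxP; rewrite -mxrank_leqif_eq.
  rewrite mxrank_tr rk' leftprojE (rightproj_eqmx kbT rkT) rkT//.
rewrite /Smap /= /S2 P2E trmx_mul leftprojE.
by rewrite (proj1 (rightproj_orthoproj kbT _)) submxMl.
Qed.

Lemma Smap_error (X : 'M[R]_(m, n)) (Z : 'M[R]_(k, n)) :
  Z *m V1 = 0 -> \rank X = k -> ((V1^T + Z)%R :=: X)%MS ->
  sqF (Smap k B X - Xb) <= 4 * (rate * sqF Z) * sqF B.
Proof.
move=> ZV Xk WX; rewrite -{1}(tsvd_PB T) -(leftprojX T) /Smap /= /S2 P2E -mulmxBl.
by apply: sqFM_le => //; exact: leftproj_half.
Qed.

(** Near Xb the projector P onto the row space of X satisfies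
    sqF ((1%:M - P) *m V1) < 1, so A = V1^T P V1 = 1 - V1^T (1 - P) V1 is invertible,
    and A^-1 V1^T P is a basis of the row space of the required form. *)
Lemma near_graph : \forall X \near Xb, \rank X = k ->
  exists2 Z : 'M[R]_(k, n), Z *m V1 = 0 & ((V1^T + Z)%R :=: X)%MS.
Proof.
pose G := pinv U1 V1 Di; pose a := 4 * (m * n)%:R * sqF G.
have a0 : 0 <= a by rewrite !mulr_ge0 ?sqF_ge0.
(* [d <= 1] and [a * d < 1], so that [a * d ^+ 2 < 1]. *)
pose d := (a + 1)^-1; have d0 : 0 < d by rewrite invr_gt0 ltr_wpDl.
have : \forall X \near Xb, `|Xb - X| < d.
  by apply/nbhs_normP; exists d.
apply: filterS => X dX Xk.
have Xle : 4 * (sqF (X - Xb) * sqF G) < 1.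
  apply: (@le_lt_trans _ _ (a * d)).
    rewrite [leRHS](_ : _ = 4 * ((m * n)%:R * d * sqF G)); last by rewrite /a; ring.
    rewrite ler_wpM2l// ler_wpM2r ?sqF_ge0//.
    apply: le_trans (sqF_le_norm _) _; rewrite ler_wpM2l// distrC.
    have d1 : d <= 1 by rewrite invf_le1 ?lerDr// ltr_wpDl.
    rewrite expr2 (le_trans (ler_pM _ _ (ltW dX) (le_trans (ltW dX) d1)))// mulr1//.
  by rewrite /d ltr_pdivrMr ?ltr_wpDl// mul1r ltrDl.
set P := rightproj k X; have Po : orthoproj P by exact: rightproj_orthoproj.
have Qo := orthoprojC Po.
have res : sqF ((1%:M - P) *m V1) < 1.
  have -> : sqF ((1%:M - P) *m V1) = sqF ((1%:M - P) *m (G *m Xb)).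
    by rewrite (pinvX T) mulmxA [RHS]sqF_isometryr ?trmxK.
  apply: le_lt_trans Xle; apply: residual_bound => //.
    by rewrite (pinvX T); exact: orthoproj_isometry.
  by apply: rightproj_best => //; rewrite (tsvd_rank T).
pose A := V1^T *m P *m V1.
have Au : A \in unitmx.
  rewrite -row_free_unit -kermx_eq0; apply/eqP/row_matrixP => i.
  set x := row i _; have xA : x *m A = 0 by rewrite /x -row_mul mulmx_ker row0.
  rewrite row0; apply: sqF_eq0.
  have xE : x = x *m (V1^T *m ((1%:M - P) *m V1)).
    have -> : V1^T *m ((1%:M - P) *m V1) = 1%:M - A.
      by rewrite mulmxBl mul1mx mulmxBr VV mulmxA.
    by rewrite mulmxBr mulmx1 xA subr0.
  have le1 : sqF x <= sqF x * sqF ((1%:M - P) *m V1).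
    rewrite {1}xE; apply: sqFM_le => //.
    rewrite -[leLHS](@sqF_isometry _ _ _ _ V1)// (mulmxA V1).
    by apply: sqF_orthoprojl_le; exact: orthoproj_isometry.
  have := sqF_ge0 x; nra.
exists (invmx A *m (V1^T *m P) - V1^T).
  by rewrite mulmxBl VV -mulmxA mulVmx// subrr.
rewrite addrC subrK.
have Wf : row_free (invmx A *m (V1^T *m P)).
  by apply/row_freeP; exists V1; rewrite -mulmxA mulVmx.
have PX : (P :=: X)%MS by exact: rightproj_eqmx.
apply/eqmxP; rewrite -mxrank_leqif_eq; first by rewrite Xk.
by rewrite -PX mulmxA submxMl.
Qed.

End ErrorBounds.
End GraphIteration.

(** * Local convergence *)

Section LocalConvergence.
Context {R : realType}.
Variables (k m n : nat) (B Xb : 'M[R]_(m, n)) (s : nat -> R) (U : 'M[R]_m) (V : 'M[R]_n)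
   (U1 : 'M[R]_(m, k)) (V1 : 'M[R]_(n, k)) (D Di : 'M[R]_k).
Hypothesis T : truncated_svd B Xb s U V U1 V1 D Di.
Let rate := (s k.+1 / s k) ^+ 2.

Lemma rate_ge0 : 0 <= rate. Proof. exact: sqr_ge0. Qed.

Lemma rate_lt1 : rate < 1.
Proof.
have [_ _ [s0 _] _ _] := tsvd_svd T; have sk := tsvd_sk_gt0 T.
by rewrite /rate expr_lt1 ?divr_ge0// ltr_pdivrMr// mul1r (tsvd_gap T).
Qed.

(** Column spaces at step l.+1 come from a half-step, so their squared errors carry
    2 * l + 1 factors [rate] instead of 2 * l.+1; the missing one goes into the
    constant, which is harmless even for rate = 0. *)
Let rate_half l (a : R) : rate * ((rate ^+ l) ^+ 2 * a) = a / rate * (rate ^+ l.+1) ^+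
  2.
Proof.
have [r0|r0] := eqVneq rate 0; first by rewrite (exprS rate l) r0 !mul0r expr0n/= mulr0.
by rewrite (exprS rate l); move: (rate ^+ l) => r; field.
Qed.

(** All errors are controlled by the graph coordinates Z of the iterates, which
    contract by the factor rate in each step. *)
Lemma local_convergence : \forall X0 \near Xb, \rank X0 = k ->
  let X l := iter l (Smap k B) X0 in
  [/\ forall l, \rank (X l) = k /\ \rank (S1 k B (X l)) = k,
      X @ \oo --> Xb,
      forall N : 'M[R]_(m, n) -> R, is_norm N ->
        R_linear_cvg N X Xb /\
        (limsup_root (fun l => N (X l - Xb)%R) <= rate%:E)%E,
      (limsup_root (fun l => op_norm (fun Z => P1 k (X l) Z - P1 k Xb Z)%R)
         <= rate%:E)%E &
      (limsup_root (fun l => op_norm (fun Z => P2 k (X l) Z - P2 k Xb Z)%R)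
         <= rate%:E)%E].
Proof.
apply: filterS (near_graph T) => X0 graph X0k X; have [Z0 Z0V W0] := graph X0k.
have r0 := rate_ge0; have r1 := rate_lt1; pose a := sqF Z0;
  have a0 : 0 <= a := sqF_ge0 _.
have iterates l := graph_iterates T l Z0V X0k W0.
have rk l : \rank (X l) = k by have [Z []] := iterates l.
have rkS l : \rank (S1 k B (X l)) = k.
  by have [Z [ZV Xk WX _]] := iterates l; have [] := half_step T ZV Xk WX.
have half l Z : sqF Z <= (rate ^+ l) ^+ 2 * a ->
    4 * (rate * sqF Z) <= 4 * (a / rate) * (rate ^+ l.+1) ^+ 2.
  by move=> Zle; rewrite -mulrA -rate_half !ler_wpM2l.
have [K1 K10 P1le] : exists2 K, 0 <= K & forall l,
    frobenius (rightproj k (X l) - rightproj k Xb) <= K * rate ^+ l.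
  apply: (@frobenius_geometric _ _ _ _ (4 * a)) => //; first exact: mulr_ge0.
  move=> l; have [Z [ZV Xk WX Zle]] := iterates l.+1.
  apply: le_trans (rightproj_graph T ZV WX) _.
  by rewrite -mulrA ler_wpM2l// mulrC.
have [K2 K20 P2le] : exists2 K, 0 <= K & forall l,
    frobenius (leftproj k (X l) - leftproj k Xb) <= K * rate ^+ l.
  apply: (@frobenius_geometric _ _ _ _ (4 * (a / rate))) => //.
    by rewrite mulr_ge0 ?divr_ge0.
  move=> l; have [Z [ZV Xk WX Zle]] := iterates l.
  rewrite (leftproj_Smap T (rkS l) (rk l.+1)).
  by apply: le_trans (leftproj_half T ZV Xk WX) _; exact: half.
have [K3 K30 Xle] : exists2 K, 0 <= K & forall l, frobenius (X l - Xb) <= K * rate ^+ l.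
  apply: (@frobenius_geometric _ _ _ _ (4 * (a / rate) * sqF B)) => //.
    by rewrite !mulr_ge0 ?divr_ge0 ?invr_ge0 ?sqF_ge0.
  move=> l; have [Z [ZV Xk WX Zle]] := iterates l.
  apply: le_trans (Smap_error T ZV Xk WX) _.
  by rewrite [leRHS]mulrAC ler_wpM2r ?sqF_ge0//; exact: half.
split=> //.
- apply/cvgrPdist_le => e e0.
  apply: filterS (eventually_geometric_le K3 r0 r1 e0) => l; apply: le_trans.
  by rewrite distrC (le_trans (norm_le_frobenius _)).
- move=> N [ND NZ N0]; have [K K0 NK] := seminorm_le_frobenius ND NZ.
  have Nle l : N (X l - Xb) <= K * K3 * rate ^+ l.
    by rewrite (le_trans (NK _))// -mulrA ler_wpM2l.
  have Nge0 Y : 0 <= N Y.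
    have := ND Y (- Y); rewrite subrr -scaleN1r NZ normrN1 mul1r.
    by rewrite -(scale0r 0) NZ normr0 mul0r; lra.
  by split; [exists (K * K3), rate|exact: (limsup_root_le r0 (fun l => Nge0 _) Nle)].
- have opK l : 0 <= op_norm (fun Z => P1 k (X l) Z - P1 k Xb Z) <= K1 * rate ^+ l.
    apply: op_norm_le => [|Z]; first by apply: mulr_ge0 => //; exact: exprn_ge0.
    rewrite !P1E -mulmxBr (le_trans (frobeniusM_le _ _))// ler_wpM2l//.
    exact: sqrtr_ge0.
  by apply: (limsup_root_le (K := K1)) => // l; have /andP[] := opK l.
- have opK l : 0 <= op_norm (fun Z => P2 k (X l) Z - P2 k Xb Z) <= K2 * rate ^+ l.
    apply: op_norm_le => [|Z]; first by apply: mulr_ge0 => //; exact: exprn_ge0.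
    rewrite !P2E -mulmxBl (le_trans (frobeniusM_le _ _))// mulrC ler_wpM2l//.
    exact: sqrtr_ge0.
  by apply: (limsup_root_le (K := K2)) => // l; have /andP[] := opK l.
Qed.

End LocalConvergence.

Theorem theorem3p3 (R : realType) (m n k : nat) (B Xbar : 'M[R]_(m, n))
    (sigma : nat -> R)
    (k_bounds : (1 <= k <= minn m n)%N)
    (B_sigma : singular_values B sigma)
    (gap : sigma k.+1 < sigma k)
    (Xbar_best : best_rank_approx k B Xbar) :
  let rate := (sigma k.+1 / sigma k) ^+ 2 in
  [/\ forall Y, best_rank_approx k B Y -> Y = Xbar,
      (* (a) *)
      forall (X0 : 'M[R]_(m, n)) (U : nat -> 'M[R]_(m, k)) (T : nat -> 'M[R]_k)
             (V : nat -> 'M[R]_(n, k)),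
        \rank X0 = k ->
        orthogonal_iteration B U T V ->
        ((V 0%N)^T == X0)%MS ->
        let X l := iter l (Smap k B) X0 in
        let Xhalf l := S1 k B (X l) in
        forall L : nat,
          (forall l, (l <= L)%N -> \rank (X l) = k) ->
          (forall l, (l < L)%N -> \rank (Xhalf l) = k) ->
          (forall l, (l < L)%N ->
             Xhalf l = B *m mp_inv (X l) *m X l /\
             X l.+1 = Xhalf l *m mp_inv (Xhalf l) *m B) /\
          (forall l, (1 <= l <= L)%N -> X l = U l *m T l *m (V l)^T),
      (* (b) *)
      differentiable (Smap k B) Xbar /\
      spectral_radius ('d (Smap k B) Xbar \o Ptan k Xbar) = rate &
      (* (c) *)
      \forall X0 \near Xbar, \rank X0 = k ->
        let X l := iter l (Smap k B) X0 in
        [/\ forall l, \rank (X l) = k /\ \rank (S1 k B (X l)) = k,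
            X @ \oo --> Xbar,
            forall N : 'M[R]_(m, n) -> R, is_norm N ->
              R_linear_cvg N X Xbar /\
              (limsup_root (fun l => N (X l - Xbar)%R) <= rate%:E)%E,
            (limsup_root (fun l => op_norm (fun Z => P1 k (X l) Z - P1 k Xbar Z)%R)
               <= rate%:E)%E &
            (limsup_root (fun l => op_norm (fun Z => P2 k (X l) Z - P2 k Xbar Z)%R)
               <= rate%:E)%E]].
Proof.
move=> rate.
have [U [V [U1 [V1 [D [Di T]]]]]] := truncated_svd_exists k_bounds B_sigma gap
  Xbar_best.
split.
- have [U' [V' svdB]] := B_sigma => Y Ybest.
  rewrite (best_rank_approxE k_bounds svdB gap Ybest).
  by rewrite (best_rank_approxE k_bounds svdB gap Xbar_best).
- move=> X0 U' S' V' _ run V0 X Xhalf L rX rXh; split; last first.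
    exact: orthogonal_iterationE.
  move=> l lL; split.
    by rewrite /Xhalf /S1 P1E (rightproj_mp_inv k_bounds) ?rX ?(ltnW lL)// mulmxA.
  by rewrite /X iterS [LHS]P2E (leftproj_mp_inv k_bounds (rXh l lL)).
- exact: spectral_radius_Smap T.
- exact: local_convergence T.
Qed.
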